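(* Let $I=[0,2\pi]$, let $a\geq 0$ and $b\in\mathbb{R}$, $b\neq 0$, be constants, and for $m\in\mathbb{N}$ let $f_{m}\in C(I)$ with $f_{m}(0)=f_{m}(2\pi)$, such that $f_{m}\to f$ in $C(I)$ as $m\to\infty$. Consider the equations $$-\frac{d^{2}u}{dx^{2}}+\frac{d^{4}u}{dx^{4}}-b\frac{du}{dx}-au=f(x),\quad x\in I, \qquad (\ast)$$ $$-\frac{d^{2}u_{m}}{dx^{2}}+\frac{d^{4}u_{m}}{dx^{4}}-b\frac{du_{m}}{dx}-au_{m}=f_{m}(x),\quad x\in I,\ m\in\mathbb{N}. \qquad (\ast_{m})$$ a) If $a>0$, then $(\ast)$ and $(\ast_{m})$ possess unique solutions $u\in H^{4}(I)$ and $u_{m}\in H^{4}(I)$ respectively, and $u_{m}\to u$ in $H^{4}(I)$ as $m\to\infty$. b) If $a=0$, suppose that $(f_{m}(x),1)_{L^{2}(I)}=0$ for all $m\in\mathbb{N}$. Then $(\ast)$ and $(\ast_{m})$ have unique solutions $u\in H_{0}^{4}(I)$ and $u_{m}\in H_{0}^{4}(I)$ respectively, and $u_{m}\to u$ in $H_{0}^{4}(I)$ as $m\to\infty$.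
   Context: Functions are complex-valued and $I=[0,2\pi]$; $C(I)$ carries the supremum norm. Here $H^{4}(I)$ denotes the space with periodic boundary conditions $$H^{4}(I)=\{u:I\to\mathbb{C}\ |\ u,u''''\in L^{2}(I),\ u(0)=u(2\pi),\ u'(0)=u'(2\pi),\ u''(0)=u''(2\pi),\ u'''(0)=u'''(2\pi)\},$$ with norm $\|u\|_{H^{4}(I)}^{2}:=\|u\|_{L^{2}(I)}^{2}+\left\|\frac{d^{4}u}{dx^{4}}\right\|_{L^{2}(I)}^{2}$ (derivatives in the weak sense). The inner product is $(f,g)_{L^{2}(I)}:=\int_{0}^{2\pi}f(x)\overline{g(x)}\,dx$, so $(f_{m}(x),1)_{L^{2}(I)}=\int_{0}^{2\pi}f_{m}(x)\,dx$. The constrained subspace is (not the usual zero-trace space) $$H_{0}^{4}(I)=\{u\in H^{4}(I)\ |\ (u(x),1)_{L^{2}(I)}=0\},$$ with the norm of $H^{4}(I)$. The equations are understood as equalities in $L^{2}(I)$. *)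

(* Defs.v *)
From mathcomp Require Import all_boot all_order all_algebra.
From mathcomp Require Import all_classical all_reals all_analysis.
From mathcomp Require Import complex.
Import Order.TTheory GRing.Theory Num.Theory.
Import numFieldNormedType.Exports.

Set Implicit Arguments.
Unset Strict Implicit.
Unset Printing Implicit Defensive.

Local Open Scope classical_set_scope.
Local Open Scope ring_scope.

(* A function on I = [0, 2 pi] is a total function R -> R[i] of which only the
   restriction to I is ever used.  Elements of L^2 and of the Sobolev spaces
   are classes modulo equality almost everywhere on I: they are given by
   representatives, and equality of classes is [ae_eqI]. *)
Section Definitions.
Variable R : realType.
Implicit Types (u v f g : R -> R[i]) (phi : R -> R).

Notation mu := (@lebesgue_measure R).
Notation modulus := (@ComplexField.Normc.normc R).

Definition I2pi : set R := `[0, 2 * pi].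

Definition I2pi_int : set R := `]0, 2 * pi[.

Definition ae_eqI u v : Prop := {ae mu, forall x, I2pi x -> u x = v x}.

Definition cintegral f : R[i] :=
  Complex (\int[mu]_(x in I2pi) complex.Re (f x))
          (\int[mu]_(x in I2pi) complex.Im (f x)).

Definition L2 f : Prop :=
  [/\ measurable_fun I2pi (fun x => complex.Re (f x)),
      measurable_fun I2pi (fun x => complex.Im (f x)) &
      (\int[mu]_(x in I2pi) (modulus (f x) ^+ 2)%:E < +oo)%E].

Definition L2norm f : R := Num.sqrt (\int[mu]_(x in I2pi) modulus (f x) ^+ 2).

Definition L2inner f g : R[i] := cintegral (fun x => f x * (g x)^*%C).

(* R[i]^o carries the topology of the modulus. *)
Definition CI f : Prop := {within I2pi, continuous (f : R -> R[i]^o)}.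

Definition supnorm f : R := sup [set modulus (f x) | x in I2pi].

Definition cvgCI (f_ : nat -> R -> R[i]) f : Prop :=
  supnorm (fun x => f_ m x - f x) @[m --> \oo] --> 0.

Definition L1loc f : Prop :=
  locally_integrable I2pi_int (fun x => complex.Re (f x)) /\
  locally_integrable I2pi_int (fun x => complex.Im (f x)).

(* Smooth functions with compact support inside ]0, 2 pi[.  Real-valued ones
   are enough to test a complex-valued function, by linearity. *)
Definition test_function phi : Prop :=
  (forall (n : nat) (x : R), derivable (derive1n n phi) x 1) /\
  exists K : set R,
    [/\ compact K, K `<=` I2pi_int & forall x, ~ K x -> phi x = 0].

Definition is_weak_deriv (k : nat) u v : Prop :=
  [/\ L1loc u, L1loc v &
      forall phi, test_function phi ->
        cintegral (fun x => u x * (derive1n k phi x)%:C%C) =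
        (-1) ^+ k * cintegral (fun x => v x * (phi x)%:C%C)].

(* A representative of the weak derivative of order k of u, which is unique
   almost everywhere when it exists; the junk value is 0. *)
Definition weak_deriv (k : nat) u : R -> R[i] :=
  xget (fun=> 0) [set v | is_weak_deriv k u v].

(* u^(k)(0) = u^(k)(2 pi): the values at the endpoints are those of the
   continuous representative on I of the weak derivative of order k.  (For
   k = 0, [is_weak_deriv 0 u w] means that w = u almost everywhere.) *)
Definition periodic_trace (k : nat) u : Prop :=
  exists w, [/\ CI w, is_weak_deriv k u w & w 0 = w (2 * pi)].

Definition H4 u : Prop :=
  [/\ L2 u, (exists v, is_weak_deriv 4 u v /\ L2 v) &
      forall k : nat, (k < 4)%N -> periodic_trace k u].

Definition H4norm u : R :=
  Num.sqrt (L2norm u ^+ 2 + L2norm (weak_deriv 4 u) ^+ 2).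

Definition H40 u : Prop := H4 u /\ L2inner u (fun=> 1) = 0.

Definition solves (a b : R) f u : Prop :=
  ae_eqI (fun x => - weak_deriv 2 u x + weak_deriv 4 u x
                   - b%:C%C * weak_deriv 1 u x - a%:C%C * u x) f.

Definition unique_solution (X : (R -> R[i]) -> Prop) (a b : R) f u : Prop :=
  [/\ X u, solves a b f u &
      forall v, X v -> solves a b f v -> ae_eqI v u].

Definition cvgH4 (u_ : nat -> R -> R[i]) u : Prop :=
  H4norm (fun x => u_ m x - u x) @[m --> \oo] --> 0.

End Definitions.

(* Main.v *)
Require Import Defs.
From mathcomp Require Import all_boot all_order all_algebra.
From mathcomp Require Import all_classical all_reals all_analysis.
From mathcomp Require Import measurable_realfun.
From mathcomp Require Import complex.
From mathcomp Require Import ring lra.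
Import Order.TTheory GRing.Theory Num.Theory.
Import numFieldNormedType.Exports.
Set Implicit Arguments.
Unset Strict Implicit.
Unset Printing Implicit Defensive.
Local Open Scope classical_set_scope.
Local Open Scope ring_scope.

(** Write D for d/dx.  The equation is p(D) u = f with the polynomial
    p = X^4 - X^2 - b X - a, which splits over the complex numbers as
    p = (X - l1)(X - l2)(X - l3)(X - l4).  A purely imaginary number i t is a
    root only if the imaginary part - b t of p(i t) vanishes; since b is
    nonzero this forces t = 0, and then a = 0.  So every root has a nonzero
    real part, except for the root 0 when a = 0 ([characteristic_roots]).
    No Fourier series is needed: the periodic problem factors into four
    periodic problems of first order, w' = l w + g, one for each root
    ([factor_solution], [factor_estimate]).

    If Re l is nonzero, the first-order problem is solved by variation of
    constants; the period map is invertible because exp(2 pi l) does not have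
    modulus 1.  Its solution satisfies a maximum principle: at a maximum of
    |w|^2 the derivative 2 Re l |w|^2 + 2 Re(g conj(w)) has a sign, and this
    gives |w| <= max |g| / |Re l|.  If l = 0 and g has mean zero, the solution
    of mean zero is a primitive of g and is bounded by 4 pi max |g|.  Mean zero
    passes from g to w and from u to the derivatives of u, so that one argument
    covers both a > 0 and a = 0, the condition on the mean being imposed under
    the hypothesis a = 0.  Composing the four steps gives a classical periodic
    solution ([classical_solution_exists]) and a bound of max |u| and max |u''''|
    by a constant times max |f| ([classical_solution_estimate]).

    It remains to identify solutions in H^4 with classical ones.  Integration by
    parts shows that a classical solution is a solution in H^4.  Conversely
    ([weak_solution_classical]) let v in H^4 be a solution and let w0, ..., w3
    be the continuous representatives of its derivatives that the boundary
    conditions provide.  Weak derivatives are unique almost everywhere by the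
    fundamental lemma of the calculus of variations ([flcv]), so the equation
    makes the fourth derivative equal almost everywhere to a continuous function
    as well; and by the lemma of du Bois-Reymond ([du_Bois_Reymond]) each w_k is
    a primitive of the next one.  The test functions that these two lemmas need
    are built from exp(-1/y).

    Uniqueness is then the estimate with f = 0, and u_m -> u in H^4 is the
    estimate for u_m - u, which solves the equation with right-hand side
    f_m - f.  When a = 0 the limit f has mean zero because the f_m do and
    converge uniformly. *)

(** * Real functions on the interval *)

Section RealInterval.
Variable R : realType.
Notation mu := (@lebesgue_measure R).
Notation I := (@I2pi R).
Implicit Types r s : R -> R.

Definition contI r := {within I, continuous r}.
(** The derivative is two-sided also at the two endpoints.  This spares all
    one-sided derivatives, and it is harmless: the functions that are built here
    are primitives of functions extended continuously beyond the interval. *)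
Definition derivI r r' := forall x : R, I x -> is_derive x 1 r (r' x).

Lemma twopi_gt0 : 0 < 2 * pi :> R.
Proof. by rewrite mulr_gt0// pi_gt0. Qed.

Lemma I2piE (x : R) : I x = (0 <= x <= 2 * pi) :> Prop.
Proof. by rewrite /I2pi /= in_itv. Qed.

Lemma I2pi0 : I 0.
Proof. by rewrite I2piE lexx ltW// twopi_gt0. Qed.

Lemma I2pi2pi : I (2 * pi).
Proof. by rewrite I2piE lexx ltW// twopi_gt0. Qed.

Lemma measurable_I2pi : measurable I.
Proof. exact: measurable_itv. Qed.

Lemma contI_cst c : contI (fun=> c).
Proof. by apply: continuous_subspaceT => x; exact: cvg_cst. Qed.

Lemma contI_continuous r : continuous r -> contI r.
Proof. exact: continuous_subspaceT. Qed.

Lemma contID r s : contI r -> contI s -> contI (fun x => r x + s x).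
Proof.
by move=> /subspace_continuousP cr /subspace_continuousP cs;
   apply/subspace_continuousP => x Ix; apply: cvgD; [exact: cr|exact: cs].
Qed.

Lemma contIM r s : contI r -> contI s -> contI (fun x => r x * s x).
Proof.
by move=> /subspace_continuousP cr /subspace_continuousP cs;
   apply/subspace_continuousP => x Ix; apply: cvgM; [exact: cr|exact: cs].
Qed.

Lemma contIN r : contI r -> contI (fun x => - r x).
Proof.
by move=> /subspace_continuousP cr;
   apply/subspace_continuousP => x Ix; apply: cvgN; exact: cr.
Qed.

Lemma contIB r s : contI r -> contI s -> contI (fun x => r x - s x).
Proof. by move=> cr cs; apply: contID => //; exact: contIN. Qed.

Lemma contIZ c r : contI r -> contI (fun x => c * r x).
Proof. by apply: contIM; exact: contI_cst. Qed.

Lemma contI_norm r : contI r -> contI (fun x => `|r x|).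
Proof.
by move=> /subspace_continuousP cr;
   apply/subspace_continuousP => x Ix; apply: cvg_norm; exact: cr.
Qed.

Lemma contI_eq r s : (forall x : R, I x -> r x = s x) -> contI r -> contI s.
Proof.
move=> rs /subspace_continuousP cr; apply/subspace_continuousP => x Ix.
rewrite [X in _ --> X](_ : _ = r x); last by rewrite -[LHS](rs _ Ix).
apply: cvg_trans (cr _ Ix); apply: near_eq_cvg.
by apply: filterS (withinT _ _) => y Iy; exact: rs.
Qed.

Lemma contI_integrable r : contI r -> mu.-integrable I (EFin \o r).
Proof. by move=> cr; apply: continuous_compact_integrable => //; exact: segment_compact. Qed.

Lemma derivI_contI r r' : derivI r r' -> contI r.
Proof.
move=> rr'; apply: derivable_within_continuous => x xI.
by apply: ex_derive; apply: rr'.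
Qed.

Lemma derivI_eq r r' s : (forall x : R, I x -> r' x = s x) ->
  derivI r r' -> derivI r s.
Proof. by move=> rs rr' x Ix; rewrite -rs//; exact: rr'. Qed.

Lemma derivI_cst c : derivI (fun=> c) (fun=> 0).
Proof. by move=> x Ix; exact: is_derive_cst. Qed.

Lemma derivID r r' s s' : derivI r r' -> derivI s s' ->
  derivI (fun x => r x + s x) (fun x => r' x + s' x).
Proof.
move=> rr' ss' x Ix; have := rr' _ Ix; have := ss' _ Ix => ? ?.
by rewrite (_ : (fun x => _) = r + s)//; exact: is_deriveD.
Qed.

Lemma derivIN r r' : derivI r r' -> derivI (fun x => - r x) (fun x => - r' x).
Proof.
move=> rr' x Ix; have := rr' _ Ix => ?.
by rewrite (_ : (fun x => _) = - r)//; exact: is_deriveN.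
Qed.

Lemma derivIB r r' s s' : derivI r r' -> derivI s s' ->
  derivI (fun x => r x - s x) (fun x => r' x - s' x).
Proof. by move=> rr' ss'; apply: derivID => //; exact: derivIN. Qed.

Lemma derivIM r r' s s' : derivI r r' -> derivI s s' ->
  derivI (fun x => r x * s x) (fun x => r' x * s x + r x * s' x).
Proof.
move=> rr' ss' x Ix; have := rr' _ Ix; have := ss' _ Ix => ? ?.
rewrite (_ : (fun x => _) = r * s)//; apply: is_derive_eq.
by rewrite addrC mulrC.
Qed.

Lemma derivIZ c r r' : derivI r r' ->
  derivI (fun x => c * r x) (fun x => c * r' x).
Proof.
move=> rr'; apply: derivI_eq (derivIM (derivI_cst c) rr').
by move=> x Ix; rewrite mul0r add0r.
Qed.

Lemma derivI_LR r r' : derivI r r' -> derivable_oo_LRcontinuous r 0 (2 * pi).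
Proof.
move=> rr'; have cr x : I x -> {for x, continuous r}.
  move=> Ix; apply/differentiable_continuous/derivable1_diffP.
  by apply: ex_derive; exact: rr'.
split.
- move=> x x02; apply: ex_derive; apply: rr'.
  by move: x02; rewrite I2piE in_itv/= => /andP[/ltW-> /ltW->].
- by apply: cvg_at_right_filter; apply: cr; exact: I2pi0.
- by apply: cvg_at_left_filter; apply: cr; exact: I2pi2pi.
Qed.

Lemma derivI_derive1 r r' : derivI r r' -> {in `]0, 2 * pi[, r^`()%classic =1 r'}.
Proof.
move=> rr' x x02; rewrite derive1E; apply: derive_val; apply: rr'.
by move: x02; rewrite I2piE in_itv/= => /andP[/ltW-> /ltW->].
Qed.

Lemma derivI_FTC r r' : derivI r r' -> contI r' ->
  \int[mu]_(x in I) r' x = r (2 * pi) - r 0.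
Proof.
move=> rr' cr'; rewrite /Rintegral /I2pi.
rewrite (@continuous_FTC2 _ r' r)//; first exact: twopi_gt0.
  exact: derivI_LR rr'.
exact: derivI_derive1.
Qed.

Lemma derivI_id : derivI id (fun=> 1).
Proof. by move=> x Ix; exact: is_derive_id. Qed.

Lemma Rintegral_I2pi_cst c : \int[mu]_(x in I) c = c * (2 * pi).
Proof.
have := derivI_FTC (derivIZ c derivI_id); rewrite !mulr1 mulr0 subr0; apply.
exact: contI_cst.
Qed.

Lemma derivI_by_parts r r' s s' : derivI r r' -> contI r' ->
    derivI s s' -> contI s' ->
  \int[mu]_(x in I) (r x * s' x) =
  r (2 * pi) * s (2 * pi) - r 0 * s 0 - \int[mu]_(x in I) (r' x * s x).
Proof.
move=> rr' cr' ss' cs'; apply: Rintegration_by_parts => //.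
- exact: twopi_gt0.
- exact: derivI_LR rr'.
- exact: derivI_derive1.
- exact: derivI_LR ss'.
- exact: derivI_derive1.
Qed.

(** Composing with this retraction of the line onto the interval extends a
    function that is continuous on the interval to a continuous one on the line. *)
Definition clampI (x : R) : R := Num.max 0 (Num.min x (2 * pi)).

Lemma clampI_id (x : R) : I x -> clampI x = x.
Proof. by rewrite I2piE /clampI => /andP[x0 x2]; rewrite min_l// max_r. Qed.

Lemma clampI_in (x : R) : I (clampI x).
Proof.
rewrite I2piE /clampI; have := twopi_gt0 => p0.
by rewrite le_max lexx/= ge_max (ltW p0) ge_min lexx orbT.
Qed.

Lemma clampI_continuous : continuous clampI.
Proof.
move=> x; apply: (@continuous_max R R (fun=> 0) (fun y => Num.min y (2 * pi))).
  exact: cst_continuous.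
apply: (@continuous_min R R id (fun=> 2 * pi)); first exact: cvg_id.
exact: cst_continuous.
Qed.

Lemma clampI_comp_continuous r : contI r -> continuous (r \o clampI).
Proof.
move=> /subspace_continuousP cr x.
apply: cvg_comp (cr _ (clampI_in x)) => A /= wA.
have := @clampI_continuous x _ wA; rewrite /= !nbhs_simpl/=.
by apply: filterS => y; apply; exact: clampI_in.
Qed.

(** The primitive starts at -1, not at 0, so that the fundamental theorem of
    calculus gives a two-sided derivative at 0 too. *)
Lemma contI_primitive s : contI s -> exists r, derivI r s.
Proof.
move=> cs; have cs' := clampI_comp_continuous cs.
exists (fun x => \int[mu]_(t in [set` `[-1, x]]) (s \o clampI) t) => x Ix.
have /andP[x0 x2] : 0 <= x <= 2 * pi by rewrite -I2piE.
have [||||] := @continuous_FTC1_closed _ (s \o clampI) (-1) x (x + 1).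
- by rewrite ltrDl.
- apply: continuous_compact_integrable; first exact: segment_compact.
  exact: continuous_subspaceT.
- by rewrite (lt_le_trans _ x0)// ltrN10.
- exact: cs'.
move=> dF F'; apply: DeriveDef; first exact: dF.
by rewrite -derive1E F'/= clampI_id.
Qed.

(** A one-sided version of the first derivative test: the maximum principle has to
    deal with maxima that are attained at an endpoint. *)
Lemma is_derive_max_right (r : R -> R) (x l d : R) : is_derive x 1 r l -> 0 < d ->
  (forall y, x <= y < x + d -> r y <= r x) -> l <= 0.
Proof.
move=> /is_derive1_caratheodory[g [gE cg gx]] d0 rmax.
rewrite leNgt; apply/negP => l0.
have /cvgrPdist_lt/(_ l l0)[e /= e0 He] := cg.
pose h := Num.min (e / 2) (d / 2).
have h0 : 0 < h by rewrite lt_min !divr_gt0.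
have he : h < e by rewrite gt_min ltr_pdivrMr// mulr2n mulrDr !mulr1 ltrDl e0.
have hd : h < d by rewrite gt_min [X in _ || X]ltr_pdivrMr// mulr2n mulrDr !mulr1 ltrDl d0 orbT.
have gp : 0 < g (x + h).
  have := He (x + h); rewrite /= opprD addNKr normrN gtr0_norm// gx.
  by move=> /(_ he); rewrite ltr_norml => /andP[_]; rewrite ltrBlDr -ltrBlDl subrr.
have := rmax (x + h); rewrite lerDl (ltW h0) ltrD2l hd => /(_ isT).
rewrite -subr_le0 gE addrAC subrr add0r leNgt => /negP; apply.
exact: mulr_gt0.
Qed.

Lemma is_derive_max_left (r : R -> R) (x l d : R) : is_derive x 1 r l -> 0 < d ->
  (forall y, x - d < y <= x -> r y <= r x) -> 0 <= l.
Proof.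
move=> dr d0 rmax; rewrite -oppr_le0.
apply: (@is_derive_max_right (r \o -%R) (- x) _ d) => //.
- have dN : is_derive (- x) 1 (-%R : R -> R) (- 1).
    by rewrite (_ : -%R = - @id R)//; exact: is_deriveN.
  have dr' : is_derive (- - x) 1 r l by rewrite opprK.
  by have := is_derive1_comp dr' dN; rewrite mulrN1.
- move=> y /andP[xy yx] /=; rewrite opprK rmax//; lra.
Qed.

End RealInterval.

(** * Complex-valued functions and the first-order periodic equation *)

Section ComplexValued.
Variable R : realType.
Notation mu := (@lebesgue_measure R).
Notation I := (@I2pi R).
Notation normc := (@ComplexField.Normc.normc R).
Notation Re := (@complex.Re R).
Notation Im := (@complex.Im R).
Implicit Types (z l : R[i]) (u v w g : R -> R[i]).

Lemma cReD z l : Re (z + l) = Re z + Re l. Proof. by case: z; case: l. Qed.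
Lemma cImD z l : Im (z + l) = Im z + Im l. Proof. by case: z; case: l. Qed.
Lemma cReN z : Re (- z) = - Re z. Proof. by case: z. Qed.
Lemma cImN z : Im (- z) = - Im z. Proof. by case: z. Qed.
Lemma cReM z l : Re (z * l) = Re z * Re l - Im z * Im l.
Proof. by case: z; case: l. Qed.
Lemma cImM z l : Im (z * l) = Re z * Im l + Im z * Re l.
Proof. by case: z; case: l. Qed.

Definition ReImE := (cReD, cImD, cReN, cImN, cReM, cImM).

Lemma complex_eq z l : Re z = Re l -> Im z = Im l -> z = l.
Proof. by case: z => a b; case: l => c d /= -> ->. Qed.

Lemma normcE z : normc z = Num.sqrt (Re z ^+ 2 + Im z ^+ 2).
Proof. by case: z. Qed.

Lemma normc_sqr z : normc z ^+ 2 = Re z ^+ 2 + Im z ^+ 2.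
Proof. by rewrite normcE sqr_sqrtr// addr_ge0// sqr_ge0. Qed.

Lemma normc_ge0 z : 0 <= normc z.
Proof. by rewrite normcE sqrtr_ge0. Qed.

Lemma Re_le_normc z : `|Re z| <= normc z.
Proof. by rewrite normcE -sqrtr_sqr ler_sqrt ?lerDl ?sqr_ge0// addr_ge0// sqr_ge0. Qed.

Lemma Im_le_normc z : `|Im z| <= normc z.
Proof. by rewrite normcE -sqrtr_sqr ler_sqrt ?lerDr ?sqr_ge0// addr_ge0// sqr_ge0. Qed.

Lemma normc_le_ReIm z : normc z <= `|Re z| + `|Im z|.
Proof.
rewrite -(@ler_pXn2r _ 2)// ?nnegrE ?normc_ge0 ?addr_ge0//.
rewrite normc_sqr sqrrD !real_normK ?num_real// lerD2r lerDl.
by rewrite mulrn_wge0// mulr_ge0.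
Qed.

Lemma dot_le_normc z l : `|Re z * Re l + Im z * Im l| <= normc z * normc l.
Proof.
have -> : normc z * normc l = normc (z * (Re l -i* Im l)%C).
  by rewrite ComplexField.Normc.normcM; congr (_ * _); rewrite !normcE /= sqrrN.
apply: le_trans (Re_le_normc _).
by rewrite cReM/= mulrN opprK.
Qed.

Definition cderiv w w' := derivI (Re \o w) (Re \o w') /\ derivI (Im \o w) (Im \o w').
Definition contC w := contI (Re \o w) /\ contI (Im \o w).

(** Continuity for the modulus amounts to continuity of the two components, by
    |Re z|, |Im z| <= |z| <= |Re z| + |Im z|; everything else is done by components. *)
Lemma CI_contC w : CI w <-> contC w.
Proof.
split=> [/subspace_continuousP cw|[/subspace_continuousP cr /subspace_continuousP ci]].
  split; apply/subspace_continuousP => x Ix; apply/cvgrPdist_lt => e e0;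
    have /cvgrPdist_lt/(_ (e%:C)%C) := cw _ Ix; rewrite ltcR e0 => /(_ isT);
    apply: filterS => y; rewrite normc_def ltcR; apply: le_lt_trans => /=.
    by have := Re_le_normc (w x - w y); rewrite normcE cReD cReN.
  by have := Im_le_normc (w x - w y); rewrite normcE cImD cImN.
apply/subspace_continuousP => x Ix; apply/cvgrPdist_lt => e.
case: e => e e'; rewrite ltcE /= => /andP[/eqP -> e0].
have /cvgrPdist_lt/(_ (e / 2)) := cr _ Ix; rewrite divr_gt0// => /(_ isT) cr'.
have /cvgrPdist_lt/(_ (e / 2)) := ci _ Ix; rewrite divr_gt0// => /(_ isT) ci'.
near=> y.
rewrite (_ : Complex e 0 = e%:C%C)// normc_def ltcR -normcE.
apply: le_lt_trans (normc_le_ReIm _) _; rewrite !ReImE (splitr e) ltrD//.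
  by near: y; exact: cr'.
by near: y; exact: ci'.
Unshelve. all: by end_near. Qed.

Lemma contCD u v : contC u -> contC v -> contC (fun x => u x + v x).
Proof.
move=> [ur ui] [vr vi]; split.
  by apply: contI_eq (contID ur vr) => x _ /=; rewrite cReD.
by apply: contI_eq (contID ui vi) => x _ /=; rewrite cImD.
Qed.

Lemma contCN u : contC u -> contC (fun x => - u x).
Proof.
move=> [ur ui]; split.
  by apply: contI_eq (contIN ur) => x _ /=; rewrite cReN.
by apply: contI_eq (contIN ui) => x _ /=; rewrite cImN.
Qed.

Lemma contCB u v : contC u -> contC v -> contC (fun x => u x - v x).
Proof. by move=> cu cv; apply: contCD => //; exact: contCN. Qed.

Lemma contCM u v : contC u -> contC v -> contC (fun x => u x * v x).
Proof.
move=> [ur ui] [vr vi]; split.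
  by apply: contI_eq (contIB (contIM ur vr) (contIM ui vi)) => x _ /=; rewrite cReM.
by apply: contI_eq (contID (contIM ur vi) (contIM ui vr)) => x _ /=; rewrite cImM.
Qed.

Lemma contC_cst c : contC (fun=> c).
Proof. by split; exact: contI_cst. Qed.

Lemma cderiv_contC u u' : cderiv u u' -> contC u.
Proof. by move=> [dr di]; split; [exact: derivI_contI dr|exact: derivI_contI di]. Qed.

Lemma cderiv_eq u u' v : (forall x : R, I x -> u' x = v x) ->
  cderiv u u' -> cderiv u v.
Proof.
by move=> uv [ur ui]; split; [apply: derivI_eq ur|apply: derivI_eq ui] => x Ix /=;
  rewrite uv.
Qed.

Lemma cderiv_cst c : cderiv (fun=> c) (fun=> 0).
Proof. by split; exact: derivI_cst. Qed.

Lemma cderivD u u' v v' : cderiv u u' -> cderiv v v' ->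
  cderiv (fun x => u x + v x) (fun x => u' x + v' x).
Proof.
move=> [ur ui] [vr vi]; split.
  have := derivID ur vr; rewrite /comp/= => /derivI_eq H.
  under eq_fun do rewrite cReD.
  by apply: H => x _; rewrite cReD.
have := derivID ui vi; rewrite /comp/= => /derivI_eq H.
under eq_fun do rewrite cImD.
by apply: H => x _; rewrite cImD.
Qed.

Lemma cderivM u u' v v' : cderiv u u' -> cderiv v v' ->
  cderiv (fun x => u x * v x) (fun x => u' x * v x + u x * v' x).
Proof.
move=> [ur ui] [vr vi]; split.
  have := derivIB (derivIM ur vr) (derivIM ui vi); rewrite /comp/= => /derivI_eq H.
  under eq_fun do rewrite cReM.
  by apply: H => x _; rewrite cReD !cReM; ring.
have := derivID (derivIM ur vi) (derivIM ui vr); rewrite /comp/= => /derivI_eq H.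
under eq_fun do rewrite cImM.
by apply: H => x _; rewrite cImD !cImM; ring.
Qed.

Lemma cderivZ c u u' : cderiv u u' ->
  cderiv (fun x => c * u x) (fun x => c * u' x).
Proof.
move=> uu'; apply: cderiv_eq (cderivM (cderiv_cst c) uu').
by move=> x Ix; rewrite mul0r add0r.
Qed.

Lemma cderivB u u' v v' : cderiv u u' -> cderiv v v' ->
  cderiv (fun x => u x - v x) (fun x => u' x - v' x).
Proof.
move=> du /(cderivZ (-1)) dv.
have := cderivD du dv.
under eq_fun do rewrite mulN1r.
by apply: cderiv_eq => x _; rewrite mulN1r.
Qed.

Lemma cintegral_FTC w w' : cderiv w w' -> contC w' ->
  cintegral w' = w (2 * pi) - w 0.
Proof.
move=> [dr di] [cr ci]; apply: complex_eq.
  by rewrite !ReImE /=; exact: derivI_FTC dr cr.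
by rewrite !ReImE /=; exact: derivI_FTC di ci.
Qed.

Lemma cintegralD u v : contC u -> contC v ->
  cintegral (fun x => u x + v x) = cintegral u + cintegral v.
Proof.
move=> [ur ui] [vr vi]; apply: complex_eq; rewrite !ReImE /=;
  rewrite -RintegralD//; try exact: contI_integrable;
  try exact: measurable_I2pi; by apply: eq_Rintegral => x _; rewrite ?cReD ?cImD.
Qed.

Lemma cintegralZ c u : contC u ->
  cintegral (fun x => c * u x) = c * cintegral u.
Proof.
move=> [ur ui]; have mI := @measurable_I2pi R; apply: complex_eq; rewrite !ReImE /=.
  rewrite -!RintegralZl//; try exact: contI_integrable.
  rewrite -RintegralB//; try (apply: contI_integrable; exact: contIZ).
  by apply: eq_Rintegral => x _; rewrite cReM.
rewrite -!RintegralZl//; try exact: contI_integrable.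
rewrite -RintegralD//; try (apply: contI_integrable; exact: contIZ).
by apply: eq_Rintegral => x _; rewrite cImM.
Qed.

Lemma cintegralB u v : contC u -> contC v ->
  cintegral (fun x => u x - v x) = cintegral u - cintegral v.
Proof.
move=> cu cv; rewrite -mulN1r -cintegralZ// -cintegralD//; last first.
  by apply: contCM => //; exact: contC_cst.
by congr cintegral; apply/funext => x; rewrite mulN1r.
Qed.

(** The maximum principle.  For N = |w|^2 the equation gives
    N' = 2 (Re l |w|^2 + Re(g conj(w))).  If Re l > 0 and N is maximal at d, with
    room to the right of d, then N'(d) <= 0, hence
    Re l |w(d)|^2 <= |g(d)| |w(d)|; if Re l < 0 the same is done on the left. *)
Lemma norm_periodic_ODE_le l w w' g M : Re l != 0 -> cderiv w w' ->
    (forall x : R, I x -> w' x = l * w x + g x) -> w 0 = w (2 * pi) ->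
    (forall x : R, I x -> normc (g x) <= M) ->
  forall x, I x -> normc (w x) <= M / `|Re l|.
Proof.
move=> l0 [dr di] wE wper gM.
pose N x := Re (w x) * Re (w x) + Im (w x) * Im (w x).
have NE x : N x = normc (w x) ^+ 2 by rewrite normc_sqr /N !expr2.
have dN := derivID (derivIM dr dr) (derivIM di di); rewrite /comp/= -/N in dN.
have [c cI cmax] : exists2 c, c \in `[0, 2 * pi] &
    forall t, t \in `[0, 2 * pi] -> N t <= N c.
  by apply: EVT_max; [exact: ltW (twopi_gt0 R)|exact: derivI_contI dN].
have p0 := twopi_gt0 R.
have M0 : 0 <= M by apply: le_trans (gM 0 _); [exact: normc_ge0|exact: I2pi0].
suff [d Id dle] : exists2 d, I d & `|Re l| * normc (w d) ^+ 2 <= M * normc (w d) /\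
    N c <= N d.
  have wd : normc (w d) <= M / `|Re l|.
    have [->|wd0] := eqVneq (normc (w d)) 0; first by rewrite divr_ge0.
    rewrite ler_pdivlMr ?normr_gt0// mulrC.
    have w0 : 0 < normc (w d) by rewrite lt_def wd0 normc_ge0.
    by rewrite -(ler_pM2r w0) -mulrA -expr2; exact: dle.1.
  move=> x Ix; apply: le_trans wd.
  rewrite -(@ler_pXn2r _ 2)// ?nnegrE ?normc_ge0// -!NE.
  by apply: le_trans dle.2; apply: cmax; rewrite in_itv/= -I2piE.
have key d : I d -> `|Re (w d) * Re (g d) + Im (w d) * Im (g d)| <= M * normc (w d).
  move=> Id; apply: le_trans (dot_le_normc _ _) _.
  by rewrite mulrC ler_wpM2r ?normc_ge0// gM.
have dNE d : I d -> is_derive d 1 N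
    (2 * (Re l * normc (w d) ^+ 2 + (Re (w d) * Re (g d) + Im (w d) * Im (g d)))).
  move=> Id; apply: is_derive_eq; first exact: dN.
  by rewrite wE// normc_sqr !ReImE; ring.
have Nper : N 0 = N (2 * pi) by rewrite /N wper.
have cI' : I c by rewrite I2piE; move: cI; rewrite in_itv.
have [lpos|lneg] : Re l > 0 \/ Re l < 0.
  by move: l0; rewrite neq_lt => /orP[|]; [right|left].
(* By periodicity a maximum at 2 pi is also one at 0, where there is room
   to the right. *)
- exists (if c == 2 * pi then 0 else c); first by case: ifP => // _; exact: I2pi0.
  set d := if _ then _ else _.
  have Id : I d by rewrite /d; case: ifP => // _; exact: I2pi0.
  have Ncd : N c = N d by rewrite /d; case: eqP => // ->.
  have d2 : d < 2 * pi.
    rewrite /d; case: eqP => // /eqP c2; rewrite lt_neqAle c2.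
    by move: cI'; rewrite I2piE => /andP[].
  split; last by rewrite Ncd.
  have : 2 * (Re l * normc (w d) ^+ 2 + (Re (w d) * Re (g d) + Im (w d) * Im (g d))) <= 0.
    apply: (is_derive_max_right (dNE _ Id) (d := 2 * pi - d)); first by rewrite subr_gt0.
    move=> y; rewrite subrKC => /andP[dy y2]; rewrite -Ncd cmax// in_itv/= (ltW y2) andbT.
    by apply: le_trans dy; move: Id; rewrite I2piE => /andP[].
  rewrite gtr0_norm//; move: (key _ Id); rewrite ler_norml => /andP[k1 k2] k3.
  lra.
- exists (if c == 0 then 2 * pi else c); first by case: ifP => // _; exact: I2pi2pi.
  set d := if _ then _ else _.
  have Id : I d by rewrite /d; case: ifP => // _; exact: I2pi2pi.
  have Ncd : N c = N d by rewrite /d; case: eqP => // ->.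
  have d2 : 0 < d.
    rewrite /d; case: eqP => // /eqP c2; rewrite lt_neqAle eq_sym c2.
    by move: cI'; rewrite I2piE => /andP[].
  split; last by rewrite Ncd.
  have : 0 <= 2 * (Re l * normc (w d) ^+ 2 + (Re (w d) * Re (g d) + Im (w d) * Im (g d))).
    apply: (is_derive_max_left (dNE _ Id) d2).
    move=> y; rewrite subrr => /andP[dy y2]; rewrite -Ncd cmax// in_itv/= (ltW dy)/=.
    by apply: le_trans y2 _; move: Id; rewrite I2piE => /andP[].
  rewrite ltr0_norm//; move: (key _ Id); rewrite ler_norml => /andP[k1 k2] k3.
  lra.
Qed.

(** By the mean value theorem r x - 2 pi M <= r y for all y; integrating over y
    bounds r x from above by 2 pi M.  The lower bound is the one for - r. *)
Lemma derivI_mean0_le (r r' : R -> R) (M : R) : derivI r r' ->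
  \int[mu]_(x in I) r x = 0 -> (forall x, I x -> `|r' x| <= M) ->
  forall x, I x -> `|r x| <= 2 * pi * M.
Proof.
move=> dr r0 rM.
suff H (q q' : R -> R) : derivI q q' -> \int[mu]_(x in I) q x = 0 ->
    (forall x, I x -> `|q' x| <= M) -> forall x, I x -> q x <= 2 * pi * M.
  move=> x Ix; rewrite ler_norml; apply/andP; split; last exact: (H r r').
  rewrite lerNl; apply: (H (fun x => - r x) (fun x => - r' x)) => //.
  - exact: derivIN.
  - under eq_Rintegral do rewrite -mulN1r.
    rewrite RintegralZl ?r0 ?mulr0//; first exact: measurable_I2pi.
    by apply: contI_integrable; exact: derivI_contI dr.
  - by move=> y Iy; rewrite normrN rM.
move=> {dr r0 rM r r'} dq q0 qM x Ix.
have lip y : I y -> q x - 2 * pi * M <= q y.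
  move=> Iy; rewrite lerBlDr -lerBlDl; apply: le_trans (ler_norm _) _.
  have M0 : 0 <= M by apply: le_trans (qM _ Ix).
  have Hlip a b : I a -> I b -> a <= b -> `|q b - q a| <= 2 * pi * M.
    move=> Ia Ib ab.
    have ab_I t : t \in `[a, b] -> I t.
      move: Ia Ib; rewrite !I2piE in_itv/= => /andP[? _] /andP[_ ?] /andP[at_ tb].
      by apply/andP; split; [exact: le_trans at_|exact: le_trans tb _].
    have [||t /ab_I It ->] := @MVT_segment _ q q' a b ab.
    - move=> t tab; apply: dq; apply: ab_I; apply: subset_itv_oo_cc tab.
    - apply: derivable_within_continuous => t tab.
      by apply: ex_derive; apply: dq; exact: ab_I.
    rewrite normrM mulrC ler_pM// ?qM// ger0_norm ?subr_ge0//.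
    by move: Ia Ib; rewrite !I2piE => /andP[? ?] /andP[? ?]; lra.
  by have [/Hlip ->//|/ltW yx] := leP y x; rewrite distrC; apply: Hlip.
have cq := contI_integrable (derivI_contI dq).
have mI := @measurable_I2pi R.
have := @le_Rintegral _ _ _ mu I (fun=> q x - 2 * pi * M) q mI
  (contI_integrable (@contI_cst R (q x - 2 * pi * M))) cq lip.
rewrite q0 Rintegral_I2pi_cst pmulr_lle0 ?twopi_gt0//.
by rewrite subr_le0.
Qed.

Lemma norm_mean0_le w w' M : cderiv w w' -> cintegral w = 0 ->
    (forall x : R, I x -> normc (w' x) <= M) ->
  forall x, I x -> normc (w x) <= 4 * pi * M.
Proof.
move=> [dr di] [w1 w2] w'M x Ix.
apply: le_trans (normc_le_ReIm _) _.
have := derivI_mean0_le dr w1 _ Ix => /(_ M) H1.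
have := derivI_mean0_le di w2 _ Ix => /(_ M) H2.
have -> : 4 * pi * M = 2 * pi * M + 2 * pi * M by ring.
rewrite lerD//.
  by apply: H1 => y Iy; apply: le_trans (Re_le_normc _) _; exact: w'M.
by apply: H2 => y Iy; apply: le_trans (Im_le_normc _) _; exact: w'M.
Qed.

(** The function x |-> exp(l x) of a real variable. *)
Definition cexp l (x : R) : R[i] :=
  Complex (expR (Re l * x) * cos (Im l * x)) (expR (Re l * x) * sin (Im l * x)).

Lemma cexp0 l : cexp l 0 = 1.
Proof. by rewrite /cexp !mulr0 expR0 cos0 sin0 mulr1 mulr0. Qed.

Lemma cexp_mulN l x : cexp l x * cexp (- l) x = 1.
Proof.
rewrite /cexp cReN cImN !mulNr cosN sinN; apply: complex_eq; rewrite ReImE /=.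
  transitivity ((expR (Re l * x) * expR (- (Re l * x))) * (cos (Im l * x) ^+ 2 + sin (Im l * x) ^+ 2)); first by ring.
  by rewrite expRxMexpNx_1 cos2Dsin2 mulr1.
by ring.
Qed.

Lemma normc_cexp l x : normc (cexp l x) = expR (Re l * x).
Proof.
by rewrite normcE /= !exprMn -mulrDr cos2Dsin2 mulr1 sqrtr_sqr ger0_norm// expR_ge0.
Qed.

Lemma is_derive_scale (k x : R) : is_derive x 1 (fun y => k * y) k.
Proof.
rewrite (_ : (fun y => k * y) = (fun=> k) * id)//.
by apply: is_derive_eq; rewrite scaler0 addr0 /GRing.scale/= mulr1.
Qed.

Lemma cderiv_cexp l : cderiv (cexp l) (fun x => l * cexp l x).
Proof.
have dc (f f' : R -> R) (k : R) : (forall x : R, is_derive x 1 f (f' x)) ->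
    derivI (fun x => f (k * x)) (fun x => k * f' (k * x)).
  move=> df x _; have Hs := is_derive_scale k x.
  have := @is_derive1_comp _ f (fun y => k * y) x _ _ (df (k * x)) Hs.
  by rewrite mulrC.
have dE := dc _ _ (Re l) (@is_derive_expR R).
have dS := dc _ _ (Im l) (@is_derive_sin R).
have dC := dc _ _ (Im l) (@is_derive_cos R).
split.
  apply: derivI_eq (derivIM dE dC) => x _.
  by rewrite /= cReM /=; ring.
apply: derivI_eq (derivIM dE dS) => x _.
by rewrite /= cImM /=; ring.
Qed.

Lemma contC_primitive g : contC g -> exists G, cderiv G g.
Proof.
move=> [/contI_primitive[Gr dr] /contI_primitive[Gi di]].
by exists (fun x => Complex (Gr x) (Gi x)); split.
Qed.

(** Variation of constants: w = exp(l x) (c + G) with G a primitive of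
    exp(- l x) g.  Periodicity is a linear equation for c, solvable because
    |exp(2 pi l)| = exp(2 pi Re l) differs from 1. *)
Lemma periodic_ODE_exists l g : Re l != 0 -> contC g ->
  exists2 w, cderiv w (fun x => l * w x + g x) & w 0 = w (2 * pi).
Proof.
move=> l0 cg.
have ce k : contC (cexp k) by apply: cderiv_contC (cderiv_cexp k).
have [G dG] := contC_primitive (contCM (ce (- l)) cg).
have e1 : 1 - cexp l (2 * pi) != 0.
  rewrite subr_eq0; apply/eqP => /(congr1 normc).
  rewrite normc_cexp ComplexField.Normc.normc1 -[LHS]expR0 => /expR_inj /esym/eqP.
  by rewrite mulf_eq0 (negbTE l0) gt_eqF ?twopi_gt0.
pose c := (cexp l (2 * pi) * G (2 * pi) - G 0) / (1 - cexp l (2 * pi)).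
exists (fun x => cexp l x * (c + G x)).
  apply: cderiv_eq (cderivM (cderiv_cexp l) (cderivD (cderiv_cst c) dG)) => x _.
  by rewrite add0r mulrA cexp_mulN mul1r mulrA.
rewrite cexp0 mul1r /c.
have : c * (1 - cexp l (2 * pi)) = cexp l (2 * pi) * G (2 * pi) - G 0.
  by rewrite /c divfK.
rewrite -/c; set E := cexp l (2 * pi) => H.
apply/eqP; rewrite -subr_eq0; apply/eqP.
transitivity (c * (1 - E) - (E * G (2 * pi) - G 0)); first by ring.
by rewrite H subrr.
Qed.

End ComplexValued.

(** * Smooth bump functions *)

Section Smooth.
Variable R : realType.
Implicit Types (f g phi : R -> R) (p q : {poly R}).

Definition smooth f := forall (n : nat) (x : R), derivable (derive1n n f) x 1.

(** A class of differentiable functions that is stable under derivation consists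
    of smooth functions.  Exhibiting such a class avoids formulas for the n-th
    derivative of a product or of a composite. *)
Lemma smooth_coind (S : (R -> R) -> Prop) :
  (forall f, S f -> (forall x : R, derivable f x 1) /\ S (f^`()%classic)) ->
  forall f, S f -> smooth f.
Proof.
move=> HS f Sf n; suff [Sn _] : S (derive1n n f) /\ True by have [] := HS _ Sn.
elim: n => [|n [IH _]]; first by [].
by rewrite derive1nS; have [] := HS _ IH.
Qed.

Lemma smooth_derivable f x : smooth f -> derivable f x 1.
Proof. by move=> /(_ 0%N x). Qed.

Lemma smooth_derive1 f : smooth f -> smooth (f^`()%classic).
Proof. by move=> sf n x; rewrite -derive1Sn; exact: sf. Qed.

Lemma smooth_is_derive f (x : R) : smooth f -> is_derive x 1 f (f^`()%classic x).
Proof. by move=> sf; rewrite derive1E; apply/derivableP; exact: smooth_derivable. Qed.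

Lemma smooth_primitive f g : (forall x : R, is_derive x 1 f (g x)) -> smooth g ->
  smooth f.
Proof.
move=> fg sg; have f'g : f^`()%classic = g.
  by apply/funext => x; rewrite derive1E; apply: derive_val.
case=> [|n] x; first by apply: ex_derive.
by rewrite derive1Sn f'g; exact: sg.
Qed.

Lemma smooth_continuous f : smooth f -> continuous f.
Proof.
move=> sf x; apply/differentiable_continuous/derivable1_diffP.
exact: smooth_derivable.
Qed.

Lemma is_deriveM_fun f g (x df dg : R) : is_derive x 1 f df -> is_derive x 1 g dg ->
  is_derive x 1 (fun y => f y * g y) (df * g x + f x * dg).
Proof.
move=> ? ?; rewrite (_ : (fun y => _) = f * g)//; apply: is_derive_eq.
by rewrite addrC mulrC.
Qed.

Lemma smooth_lincomb f g c : smooth f -> smooth g ->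
  smooth (fun x => f x + c * g x).
Proof.
move=> sf sg.
apply: (@smooth_coind (fun h => exists f g, [/\ smooth f, smooth g &
    h = (fun x => f x + c * g x)])); last by exists f, g.
move=> _ {f g sf sg} [f [g [sf sg ->]]].
have D (x : R) : is_derive x 1 (fun x => f x + c * g x)
    (f^`()%classic x + c * g^`()%classic x).
  have df := smooth_is_derive x sf; have dg := smooth_is_derive x sg.
  have := is_deriveM_fun (is_derive_cst c x 1) dg.
  rewrite mul0r add0r => dcg.
  exact: (is_deriveD df dcg).
split=> [x|]; first by apply: ex_derive.
exists (f^`()%classic), (g^`()%classic); split; try exact: smooth_derive1.
by apply/funext => x; rewrite derive1E; apply: derive_val.
Qed.

(** Sums of products of members of B: by the Leibniz rule this class is stable
    under derivation as soon as B is. *)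
Inductive prodsum (B : (R -> R) -> Prop) : (R -> R) -> Prop :=
| prodsum_mul f g : B f -> B g -> prodsum B (fun x => f x * g x)
| prodsum_add f g : prodsum B f -> prodsum B g -> prodsum B (fun x => f x + g x).

Lemma smoothM f g : smooth f -> smooth g -> smooth (fun x => f x * g x).
Proof.
move=> sf sg; apply: (@smooth_coind (prodsum smooth)); last exact: prodsum_mul.
move=> {sf sg f g} h; elim=> {h} [f g sf sg|f g _ [df Sf] _ [dg Sg]].
  have D (x : R) : is_derive x 1 (fun x => f x * g x)
      (f^`()%classic x * g x + f x * g^`()%classic x).
    by apply: is_deriveM_fun; exact: smooth_is_derive.
  split=> [x|]; first by apply: ex_derive.
  rewrite (_ : _^`()%classic = fun x => f^`()%classic x * g x + f x * g^`()%classic x).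
    by apply: prodsum_add; apply: prodsum_mul => //; exact: smooth_derive1.
  by apply/funext => x; rewrite derive1E; apply: derive_val.
have D (x : R) : is_derive x 1 (fun x => f x + g x) (f^`()%classic x + g^`()%classic x).
  by rewrite !derive1E; apply: is_deriveD; exact: derivableP.
split=> [x|]; first by apply: ex_derive.
rewrite (_ : _^`()%classic = fun x => f^`()%classic x + g^`()%classic x).
  exact: prodsum_add.
by apply/funext => x; rewrite derive1E; apply: derive_val.
Qed.

(** The functions p(1/y) exp(-1/y), extended by 0 to y <= 0.  This class contains
    exp(-1/y) itself and is stable under derivation, which replaces p by
    X^2 (p - p'). *)
Definition flat p (y : R) : R := if 0 < y then p.[y^-1] * expR (- y^-1) else 0.

(** Since t^n <= n! exp(t), the constant can be read off the coefficients. *)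
Lemma horner_le_expR p : exists2 C, 0 <= C & forall t : R, 0 <= t -> `|p.[t]| <= C * expR t.
Proof.
exists (\sum_(i < size p) `|p`_i| * i`!%:R).
  by apply: sumr_ge0 => i _; rewrite mulr_ge0.
move=> t t0; rewrite horner_coef; apply: le_trans (ler_norm_sum _ _ _) _.
rewrite mulr_suml; apply: ler_sum => i _; rewrite normrM -mulrA ler_wpM2l//.
rewrite normrX ger0_norm//; case: (nat_of_ord i) => [|n].
  rewrite expr0 fact0 mul1r; apply: le_trans (expR_ge1Dx t).
  by rewrite lerDl.
have := @expR_ge1Dxn R t n t0.
rewrite -[X in _ -> _ <= X]mulrC -ler_pdivrMr ?ltr0n ?fact_gt0// => H.
by apply: le_trans H; rewrite lerDr.
Qed.

(** The bound of [horner_le_expR] for p X, at t = 1/y. *)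
Lemma flat_le p : exists C, forall y, `|flat p y| <= C * `|y|.
Proof.
have [C C0 HC] := horner_le_expR (p * 'X); exists C => y.
rewrite /flat; case: ifPn => [y0|_]; last by rewrite normr0 mulr_ge0.
have := HC y^-1; rewrite invr_ge0 (ltW y0) => /(_ isT).
rewrite hornerM hornerX normrM [`|y^-1|]gtr0_norm ?invr_gt0// ler_pdivrMr// => H.
rewrite normrM [`|expR _|]ger0_norm ?expR_ge0// (gtr0_norm y0) expRN.
by rewrite ler_pdivrMr ?expR_gt0// mulrAC.
Qed.

Lemma flat_cvg0 p : {for 0, continuous (flat p)}.
Proof.
have f0 : flat p 0 = 0 by rewrite /flat ltxx.
have [C HC] := flat_le p.
apply/cvgrPdist_le => e e0; rewrite f0.
have C0 : 0 < `|C| + 1 by rewrite ltr_wpDl.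
near=> y; rewrite sub0r normrN; apply: le_trans (HC y) _.
have : `|y| <= e / (`|C| + 1).
  rewrite -[y]subr0 distrC; near: y; apply: cvgr_dist_le; first exact: cvg_id.
  by rewrite divr_gt0.
rewrite ler_pdivlMr// mulrC; apply: le_trans.
by rewrite ler_wpM2r// (le_trans (ler_norm C))// lerDl.
Unshelve. all: by end_near. Qed.

(** At y = 0 the difference quotient of the function attached to p is the function
    attached to p X, which tends to 0. *)
Lemma flat_is_derive p (y : R) :
  is_derive y 1 (flat p) (flat ('X^2 * (p - p^`())) y).
Proof.
have [y0|y0|<-] := ltgtP 0 y.
- apply: (@near_eq_is_derive _ _ _ (fun y : R => p.[y^-1] * expR (- y^-1))).
    near=> z; rewrite /flat ifT//; near: z; exact: lt_nbhsr.
  have dV : is_derive y 1 (fun z : R => z^-1) (- y ^- 2).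
    have := @is_deriveV _ id y 1 1; rewrite gt_eqF// => /(_ isT (is_derive_id _ _)).
    by rewrite /GRing.scale/= mulr1.
  have dp : is_derive (y^-1) 1 (horner p) (p^`().[y^-1]).
    by rewrite derivE derive1E; apply/derivableP; exact: derivable_horner.
  have dNV : is_derive y 1 (fun z : R => - z^-1) (y ^- 2).
    by have := is_deriveN dV; rewrite opprK.
  have H := is_deriveM_fun (@is_derive1_comp _ (horner p) (fun z => z^-1) y _ _ dp dV)
    (@is_derive1_comp _ expR (fun z => - z^-1) y _ _ (is_derive_expR (- y^-1)) dNV).
  apply: is_derive_eq H _; rewrite /flat y0 !hornerE /= exprVn; ring.
- apply: (@near_eq_is_derive _ _ _ (fun=> 0)).
    near=> z; rewrite /flat ifF//; apply/negbTE; rewrite -leNgt ltW//.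
    by near: z; exact: lt_nbhsl.
  by rewrite /flat ifF ?(lt_gtF y0)//; exact: is_derive_cst.
- apply/is_derive1_caratheodory; exists (flat (p * 'X)); split.
  + move=> z; rewrite [in X in _ - X]/flat ltxx !subr0 /flat.
    case: ifPn => [z0|_]; last by rewrite mul0r.
    by rewrite hornerM hornerX; field; rewrite gt_eqF.
  + exact: flat_cvg0.
  + by rewrite /flat ltxx.
Unshelve. all: by end_near. Qed.

Lemma smooth_flat p k c : smooth (fun x => flat p (k * x + c)).
Proof.
apply: (@smooth_coind (fun f => exists q a, f = fun x => a * flat q (k * x + c))).
  move=> _ [q [a ->]].
  have D (x : R) : is_derive x 1 (fun x => a * flat q (k * x + c))
      (a * k * flat ('X^2 * (q - q^`())) (k * x + c)).
    have d1 : is_derive x 1 (fun x => k * x + c) k.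
      have dk := is_deriveM_fun (is_derive_cst k x 1) (is_derive_id x 1).
      have := is_deriveD dk (is_derive_cst c x 1).
      by rewrite mul0r add0r mulr1 addr0.
    have d2 := @is_derive1_comp _ (flat q) (fun x => k * x + c) x _ _
      (flat_is_derive q (k * x + c)) d1.
    have := is_deriveM_fun (is_derive_cst a x 1) d2.
    by rewrite mul0r add0r [_ * k]mulrC mulrA; exact.
  split=> [x|]; first by apply: ex_derive.
  exists ('X^2 * (q - q^`())), (a * k).
  by apply/funext => x; rewrite derive1E; apply: derive_val.
by exists p, 1; apply/funext => x; rewrite mul1r.
Qed.

(** A bump supported in the interval from c to d which increases, as n grows, to the
    indicator function of its interior. *)
Definition itv_bump (c d : R) (n : nat) (x : R) : R :=
  flat 1 (n.+1%:R * (x - c)) * flat 1 (n.+1%:R * (d - x)).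

Lemma flat1_ge0 y : 0 <= flat 1 y.
Proof. by rewrite /flat; case: ifP => // _; rewrite hornerC mul1r expR_ge0. Qed.

Lemma flat1_le1 y : flat 1 y <= 1.
Proof.
rewrite /flat; case: ifP => // y0; rewrite hornerC mul1r -[leRHS]expR0 ler_expR.
by rewrite oppr_le0 invr_ge0 ltW.
Qed.

Lemma smooth_itv_bump c d n : smooth (itv_bump c d n).
Proof.
rewrite (_ : itv_bump c d n = fun x => flat 1 (n.+1%:R * x + (- n.+1%:R * c)) *
  flat 1 (- n.+1%:R * x + n.+1%:R * d)).
  by apply: smoothM; exact: smooth_flat.
by apply/funext => x; rewrite /itv_bump; congr (flat _ _ * flat _ _); ring.
Qed.

Lemma itv_bump_out c d n x : ~ (`]c, d[%classic x) -> itv_bump c d n x = 0.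
Proof.
rewrite /= in_itv/= => /negP; rewrite negb_and -!leNgt => /orP[xc|dx]; rewrite /itv_bump.
  rewrite {1}/flat ifF ?mul0r//; apply/negbTE.
  by rewrite -leNgt pmulr_rle0 ?ltr0n// subr_le0.
rewrite [X in _ * X]/flat ifF ?mulr0//; apply/negbTE.
by rewrite -leNgt pmulr_rle0 ?ltr0n// subr_le0.
Qed.

Lemma itv_bump_ge0 c d n x : 0 <= itv_bump c d n x.
Proof. by rewrite mulr_ge0 ?flat1_ge0. Qed.

Lemma itv_bump_le1 c d n x : itv_bump c d n x <= 1.
Proof. by rewrite mulr_ile1 ?flat1_ge0 ?flat1_le1. Qed.

Lemma flat1_cvg1 (y : R) : 0 < y -> flat 1 (n.+1%:R * y) @[n --> \oo] --> (1 : R).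
Proof.
move=> y0.
have -> : (fun n : nat => flat 1 (n.+1%:R * y)) = (fun n => expR (- y^-1 * n.+1%:R^-1)).
  apply/funext => n; rewrite /flat mulr_gt0 ?ltr0n// hornerC mul1r invfM.
  by rewrite [_^-1 * y^-1]mulrC mulNr.
suff : expR (- y^-1 * n.+1%:R^-1) @[n --> \oo] --> expR (- y^-1 * 0).
  by rewrite mulr0 expR0.
apply: continuous_cvg; first exact: continuous_expR.
by apply: cvgZr; exact: cvg_harmonic.
Qed.

Lemma itv_bump_cvg1 (c d x : R) : c < x < d -> itv_bump c d n x @[n --> \oo] --> (1 : R).
Proof.
move=> /andP[cx xd]; rewrite -[X in _ --> X]mulr1.
by apply: cvgM; apply: flat1_cvg1; rewrite subr_gt0.
Qed.

End Smooth.

(** * The fundamental lemma of the calculus of variations *)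

Section TestFunctions.
Variable R : realType.
Notation mu := (@lebesgue_measure R).
Notation I := (@I2pi R).
Notation J := (@I2pi_int R).
Implicit Types (h r s phi psi : R -> R).

Lemma I2pi_intS : J `<=` I.
Proof. by move=> x; rewrite /I2pi_int /I2pi /= !in_itv/= => /andP[/ltW-> /ltW->]. Qed.

(** The compact support lies in a closed interval inside the open one, between its
    minimum and its maximum. *)
Lemma test_support phi : test_function phi ->
  exists m M, [/\ 0 < m, m <= M, M < 2 * pi & forall x, ~ (m <= x <= M) -> phi x = 0].
Proof.
move=> [_ [K [cK KJ phi0]]].
have [K0|/set0P K0] := eqVneq K set0.
  exists pi, pi; rewrite pi_gt0 lexx; split => //.
    by rewrite mulr_natl mulr2n ltrDl pi_gt0.
  by move=> x _; apply: phi0; rewrite K0.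
have cid : {within K, continuous (@id R)}.
  by apply: continuous_subspaceT => x; exact: cvg_id.
have [M KM HM] := compact_EVT_max K0 cK cid.
have [m Km Hm] := compact_EVT_min K0 cK cid.
rewrite !inE in KM Km.
exists m, M; split.
- by have := KJ _ Km; rewrite /I2pi_int /= in_itv/= => /andP[].
- by apply: HM; rewrite inE.
- by have := KJ _ KM; rewrite /I2pi_int /= in_itv/= => /andP[].
- move=> x xmM; apply: phi0 => Kx; apply: xmM.
  by rewrite Hm ?HM// inE.
Qed.

Lemma test_smooth phi : test_function phi -> smooth phi.
Proof. by case. Qed.

Lemma supported_smooth_test phi (m M : R) : smooth phi -> 0 < m -> M < 2 * pi ->
  (forall x, ~ (m <= x <= M) -> phi x = 0) -> test_function phi.
Proof.
move=> sphi m0 M2 phi0; split=> //; exists `[m, M]%classic; split.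
- exact: segment_compact.
- move=> x; rewrite /I2pi_int /= !in_itv/= => /andP[mx xM].
  by rewrite (lt_le_trans m0 mx) (le_lt_trans xM M2).
- by move=> x; rewrite /= in_itv/=; exact: phi0.
Qed.

Lemma test_bump (c d : R) n : 0 < c -> d < 2 * pi -> test_function (itv_bump c d n).
Proof.
move=> c0 d2; apply: (@supported_smooth_test _ c d) => //; first exact: smooth_itv_bump.
move=> x xcd; apply: itv_bump_out => /=; rewrite in_itv/= => /andP[cx xd].
by apply: xcd; rewrite !ltW.
Qed.

Lemma test_derive1 phi : test_function phi -> test_function (phi^`()%classic).
Proof.
move=> tphi; have [m [M [m0 mM M2 phi0]]] := test_support tphi.
apply: (@supported_smooth_test _ m M) => //; first exact/smooth_derive1/test_smooth.
move=> x /negP; rewrite negb_and -!ltNge => xmM; rewrite derive1E.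
rewrite -[RHS](derive_cst (0 : R) x 1); apply: near_eq_derive.
case/orP : xmM => [xm|Mx].
  near=> y; rewrite phi0//; apply/negP; rewrite negb_and -!ltNge; apply/orP; left.
  by near: y; exact: lt_nbhsl.
near=> y; rewrite phi0//; apply/negP; rewrite negb_and -!ltNge; apply/orP; right.
by near: y; exact: lt_nbhsr.
Unshelve. all: by end_near. Qed.

Lemma test_lincomb phi psi c : test_function phi -> test_function psi ->
  test_function (fun x => phi x + c * psi x).
Proof.
move=> tp tq; have [m [M [m0 mM M2 phi0]]] := test_support tp.
have [m' [M' [m0' mM' M2' psi0]]] := test_support tq.
apply: (@supported_smooth_test _ (Num.min m m') (Num.max M M')).
- by apply: smooth_lincomb; exact: test_smooth.
- by rewrite lt_min m0.
- by rewrite gt_max M2.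
- move=> x xmM; rewrite phi0 ?psi0 ?mulr0 ?addr0//.
    move=> /andP[mx xM]; apply: xmM.
    by rewrite ge_min mx orbT le_max xM orbT.
  move=> /andP[mx xM]; apply: xmM.
  by rewrite ge_min mx le_max xM.
Qed.

Lemma test_contI phi : test_function phi -> contI phi.
Proof. by move=> tp; apply/contI_continuous/smooth_continuous/test_smooth. Qed.

Lemma test_derivI phi : test_function phi -> derivI phi (phi^`()%classic).
Proof. by move=> tp x _; exact/smooth_is_derive/test_smooth. Qed.

Lemma test_boundary phi : test_function phi -> phi 0 = 0 /\ phi (2 * pi) = 0.
Proof.
move=> /test_support[m [M [m0 mM M2 phi0]]]; split; apply: phi0; apply/negP;
  rewrite negb_and -!ltNge; first by rewrite m0.
by rewrite M2 orbT.
Qed.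

Lemma locally_integrable_sub h (c d : R) : 0 < c -> d < 2 * pi ->
  locally_integrable J h -> mu.-integrable `[c, d] (EFin \o h).
Proof.
move=> c0 d2 [mh oJ hK].
have cdJ : `[c, d] `<=` J.
  move=> x; rewrite /I2pi_int /= !in_itv/= => /andP[cx xd].
  by rewrite (lt_le_trans c0 cx) (le_lt_trans xd d2).
apply/integrableP; split.
  by apply/measurable_EFinP; apply: measurable_funS mh => //; exact: open_measurable.
by apply: hK => //; exact: segment_compact.
Qed.

Lemma contI_locally r : contI r -> locally_integrable J r.
Proof.
move=> cr; apply: open_integrable_locally.
  by rewrite /I2pi_int; exact: interval_open.
apply: (integrableS _ _ _ (contI_integrable cr)).
- exact: measurable_itv.
- exact: measurable_itv.
- exact: I2pi_intS.
Qed.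

Lemma integrable_supported (A D : set R) (f : R -> R) :
  measurable A -> measurable D -> A `<=` D -> (forall x, ~ A x -> f x = 0) ->
  mu.-integrable A (EFin \o f) -> mu.-integrable D (EFin \o f).
Proof.
move=> mA mD AD f0 /integrable_mkcond => /(_ mA) fA.
apply/integrable_mkcond => //; move: fA; congr (_.-integrable _ _).
apply/funext => x; rewrite !patchE.
case: ifPn => [|xA]; first by rewrite inE => /AD xD; rewrite mem_set.
case: ifPn => // _; rewrite /= f0// => Ax; move: xA; rewrite mem_set//.
Qed.

Lemma Rintegral_supported (A D : set R) (f : R -> R) :
  A `<=` D -> (forall x, ~ A x -> f x = 0) ->
  \int[mu]_(x in D) f x = \int[mu]_(x in A) f x.
Proof.
move=> AD f0; rewrite Rintegral_mkcond [RHS]Rintegral_mkcond.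
congr (Rintegral _ _ _); apply/funext => x; rewrite !patchE.
case: ifPn => [xD|xD]; last first.
  by rewrite ifN//; apply: contra xD; rewrite !inE; exact: AD.
by case: ifPn => // xA; rewrite f0// => Ax; move: xA; rewrite mem_set//.
Qed.

(** A locally integrable function may fail to be integrable near 0 and 2 pi, but the
    test function vanishes there. *)
Lemma integrable_test h phi : locally_integrable J h -> test_function phi ->
  mu.-integrable I (EFin \o (fun x => h x * phi x)).
Proof.
move=> lh tphi; have [m [M [m0 mM M2 phi0]]] := test_support tphi.
apply: (@integrable_supported `[m, M]).
- exact: measurable_itv.
- exact: measurable_itv.
- move=> x; rewrite /I2pi /= !in_itv/= => /andP[mx xM].
  by rewrite (ltW (lt_le_trans m0 mx)) (ltW (le_lt_trans xM M2)).
- by move=> x; rewrite /= in_itv/= => /phi0 ->; rewrite mulr0.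
have cphi : {within `[m, M], continuous phi}.
  by apply: continuous_subspaceT; exact/smooth_continuous/test_smooth.
have := @integrableMl _ _ _ mu `[m, M] (measurable_itv _) (EFin \o h) phi
  (locally_integrable_sub m0 M2 lh).
apply.
- by apply: subspace_continuous_measurable_fun => //; exact: measurable_itv.
- have /compact_bounded[B [_ mrt]] := continuous_compact cphi (@segment_compact _ m M).
  by exists B; split; rewrite ?num_real // => ? ? ? ?; exact: mrt.
Qed.

Lemma ae_mono2 (P Q S : R -> Prop) :
  {ae mu, forall x, P x} -> {ae mu, forall x, Q x} ->
  (forall x, P x -> Q x -> S x) -> {ae mu, forall x, S x}.
Proof.
move=> HP HQ PQS; have F := ae_filter_ringOfSetsType mu.
by apply: filterS2 HP HQ.
Qed.

Lemma ae_mono (P S : R -> Prop) :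
  {ae mu, forall x, P x} -> (forall x, P x -> S x) -> {ae mu, forall x, S x}.
Proof. by move=> HP PS; apply: (ae_mono2 HP HP) => x Px _; exact: PS. Qed.

(** The two endpoints form a null set. *)
Lemma ae_eq_I2pi_int (P : R -> Prop) :
  {ae mu, forall x, J x -> P x} -> {ae mu, forall x, I x -> P x}.
Proof.
move=> HJ; have H0 (a : R) : {ae mu, forall x, x <> a}.
  exists [set a]; split; [exact: measurable_set1|exact: lebesgue_measure_set1|].
  by move=> x /= /contrapT.
apply: ae_mono2 HJ (ae_mono2 (H0 0) (H0 (2 * pi)) (fun x => @conj _ _)) _.
move=> x xJ [x0 x2] Ix.
apply: xJ; move: Ix; rewrite I2piE /I2pi_int /= in_itv/= => /andP[h1 h2].
by apply/andP; split; rewrite lt_neqAle ?h1 ?h2 andbT; [rewrite eq_sym|]; apply/eqP.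
Qed.

(** Dominated convergence along the bumps [itv_bump], whose limit is the indicator
    function of the interval. *)
Lemma flcv_interval h (c d : R) : 0 < c -> d < 2 * pi -> locally_integrable J h ->
  (forall phi, test_function phi -> \int[mu]_(x in I) (h x * phi x) = 0) ->
  (\int[mu]_(x in `]c, d[) (h x)%:E = 0)%E.
Proof.
move=> c0 d2 lh h0.
have ih : mu.-integrable `]c, d[ (EFin \o h).
  apply: (integrableS _ _ _ (locally_integrable_sub c0 d2 lh)) => //.
  exact: subset_itv_oo_cc.
have mh : measurable_fun `]c, d[ h by apply/measurable_EFinP; exact: measurable_int ih.
have mb n : measurable_fun `]c, d[ (itv_bump c d n).
  by apply: measurable_funTS; apply: continuous_measurable_fun;
    exact/smooth_continuous/smooth_itv_bump.
have [|||||_ _ H] := @dominated_convergence _ _ _ mu `]c, d[ (measurable_itv _)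
  (fun n x => (h x * itv_bump c d n x)%:E) (EFin \o h) (fun x => `|h x|%:E).
- by move=> n; apply/measurable_EFinP; apply: measurable_funM; [exact: mh|exact: mb].
- exact/measurable_EFinP.
- apply: aeW => x; rewrite /= in_itv/= => xcd; apply: cvg_EFin; first by near=> n.
  rewrite -[X in _ --> X]mulr1 /comp/=.
  by apply: cvgM; [exact: cvg_cst|exact: itv_bump_cvg1].
- exact: (integrable_abse ih).
- apply: aeW => x n _ /=; rewrite lee_fin normrM ler_piMr//.
  by rewrite ger0_norm ?itv_bump_le1// itv_bump_ge0.
apply: (cvg_unique _ H) => //.
rewrite (_ : [sequence _]_n = cst 0%E); first exact: cvg_cst.
apply/funext => n /=.
have tb := test_bump n c0 d2.
have sub : `]c, d[ `<=` I.
  move=> x; rewrite I2piE /= in_itv/= => /andP[cx xd].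
  by rewrite (ltW (lt_trans c0 cx)) (ltW (lt_trans xd d2)).
have := h0 _ tb; rewrite (@Rintegral_supported `]c, d[)//; last first.
  by move=> x /itv_bump_out ->; rewrite mulr0.
move=> E; apply/eqP; rewrite -fine_eq0; first by apply/eqP; exact: E.
apply: integrable_fin_num; first exact: measurable_itv.
by apply: (integrableS _ _ _ (integrable_test lh tb)) => //; exact: measurable_itv.
Unshelve. all: by end_near. Qed.

(** The fundamental lemma of the calculus of variations.  All integrals of h over
    subintervals vanish, so by Lebesgue differentiation h, the derivative almost
    everywhere of its primitive, is 0. *)
Theorem flcv h : locally_integrable J h ->
  (forall phi, test_function phi -> \int[mu]_(x in I) (h x * phi x) = 0) ->
  {ae mu, forall x, I x -> h x = 0}.
Proof.
move=> lh h0; apply: ae_eq_I2pi_int.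
(* h is only locally integrable, so Lebesgue differentiation is applied to its
   restrictions to an exhaustion of the open interval. *)
pose c n : R := n.+1%:R^-1; pose d n : R := 2 * pi - c n.
have c0 n : 0 < c n by rewrite invr_gt0.
have d2 n : d n < 2 * pi by rewrite ltrBlDr ltrDl.
suff H : forall n, {ae mu, forall x, c n < x < d n -> h x = 0}.
  apply: (ae_mono (ae_foralln H)) => x Hx.
  rewrite /I2pi_int /= in_itv/= => /andP[x0 x2].
  have : \forall n \near \oo, c n < x < d n.
    have lt e : 0 < e -> \forall n \near \oo, c n < e.
      by move=> e0; apply: (cvgr_lt _ (@cvg_harmonic R)).
    near=> n; apply/andP; split; first by near: n; exact: lt.
    rewrite /d ltrBrDr -ltrBrDl; near: n; apply: lt.
    by rewrite subr_gt0.
  by case=> N _ /(_ N (leqnn _)); exact: Hx.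
move=> n; pose hn := h \_ `[c n, d n].
have ihn : mu.-integrable setT (EFin \o hn).
  apply: (@integrable_supported `[c n, d n]) => //.
  - by move=> x xcd; rewrite /hn patchE memNset.
  - apply: eq_integrable (locally_integrable_sub (c0 n) (d2 n) lh) => //.
    by move=> x xcd; rewrite /= /hn patchE xcd.
have lhn : locally_integrable setT hn.
  by apply: open_integrable_locally => //; exact: openT.
have ihy y : mu.-integrable [set` Interval (BRight (c n)) (BRight y)] (EFin \o hn).
  exact: (integrableS _ _ _ ihn).
apply: (ae_mono (FTC1 ihy lhn)) => x Hx /andP[cx xd].
have [_] := Hx cx; rewrite /hn patchE mem_set; last by rewrite /= in_itv/= !ltW.
move=> <-; rewrite derive1E -[RHS](derive_cst (0 : R) x 1).
apply: near_eq_derive; near=> y.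
have cy : c n < y by near: y; exact: lt_nbhsr.
have yd : y < d n by near: y; exact: lt_nbhsl.
rewrite -Rintegral_itv_bndo_bndc; last first.
  by apply: (integrableS _ _ _ ihn).
rewrite /Rintegral.
under eq_integral => z.
  rewrite inE/= in_itv/= => /andP[cz zy].
  rewrite /hn patchE mem_set; last by rewrite /= in_itv/= (ltW cz) (ltW (lt_trans zy yd)).
  over.
by rewrite flcv_interval// (lt_trans yd).
Unshelve. all: by end_near. Qed.

(** A set of full measure is dense: its complement contains no interval. *)
Lemma ae_I2pi_exists (P : R -> Prop) (x d : R) : {ae mu, forall y, I y -> P y} ->
  I x -> 0 < d -> exists y, [/\ I y, `|x - y| < d & P y].
Proof.
move=> HP; rewrite I2piE => /andP[x0 x2] d0; have p0 := twopi_gt0 R.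
pose l := Num.max 0 (x - d); pose r := Num.min (2 * pi) (x + d).
have lr : l < r by rewrite lt_min !gt_max p0 ltrBlDr; apply/andP; split; lra.
apply: contrapT => /forallNP H.
have [N [mN N0 HN]] := HP.
have lrN : `]l, r[ `<=` N.
  move=> y; rewrite /= in_itv/= lt_min gt_max => /andP[/andP[y0 xy] /andP[y2 yx]].
  apply: HN => /= HPy; apply: (H y); split.
  - by rewrite I2piE (ltW y0) (ltW y2).
  - by rewrite ltr_norml; apply/andP; split; lra.
  - by apply: HPy; rewrite I2piE (ltW y0) (ltW y2).
have E : mu `]l, r[%classic = 0%E.
  apply: measure_negligible; first exact: measurable_itv.
  by exists N; split.
move: E; rewrite lebesgue_measure_itv/= lte_fin lr => -[] /eqP.
by rewrite subr_eq0 gt_eqF.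
Qed.

Lemma contI_ae_eq r s : contI r -> contI s ->
  {ae mu, forall x, I x -> r x = s x} -> forall x, I x -> r x = s x.
Proof.
move=> cr cs rs x Ix; apply/eqP; rewrite -subr_eq0; apply/eqP.
have /subspace_continuousP/(_ x Ix)/cvgrPdist_lt c := contIB cr cs.
apply/eqP; rewrite -normr_le0; apply/ler_addgt0Pr => e e0; rewrite add0r.
have [d /= d0 Hd] := c e e0.
have [y [Iy xy ryE]] := ae_I2pi_exists rs Ix d0.
have : `|(r x - s x) - (r y - s y)| < e by exact: Hd y xy Iy.
by rewrite ryE subrr subr0 => /ltW.
Qed.

(** If every test function had integral 0, the function 1 would vanish almost
    everywhere by [flcv]. *)
Lemma test_integral_neq0 : exists2 eta, test_function eta & \int[mu]_(x in I) eta x != 0.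
Proof.
apply: contrapT => H.
have one0 : {ae mu, forall x, I x -> (1 : R) = 0}.
  apply: (@flcv (fun=> 1)); first exact/contI_locally/contI_cst.
  move=> phi tphi; under eq_Rintegral do rewrite mul1r.
  by apply/eqP/negPn/negP => phi0; apply: H; exists phi.
have [y [_ _ /eqP]] := ae_I2pi_exists one0 (I2pi0 R) (@ltr01 R).
by rewrite oner_eq0.
Qed.

(** The primitive vanishes before the support of psi, and after it because the
    integral of psi is 0. *)
Lemma test_primitive psi : test_function psi -> \int[mu]_(x in I) psi x = 0 ->
  exists2 phi, test_function phi & phi^`()%classic = psi.
Proof.
move=> tpsi psi0; have [m [M [m0 mM M2 H0]]] := test_support tpsi.
have cpsi : continuous psi by exact/smooth_continuous/test_smooth.
pose phi x := \int[mu]_(t in [set` `[-1, x]]) psi t.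
have phi_l x : x < m -> phi x = 0.
  move=> xm; rewrite /phi; under eq_Rintegral => t.
    rewrite inE /= in_itv/= => /andP[_ tx].
    rewrite H0; last by apply/negP; rewrite negb_and -ltNge (le_lt_trans tx xm).
    over.
  by rewrite /Rintegral integral0.
have phi_r x : M < x -> phi x = 0.
  move=> Mx; rewrite -psi0 /phi.
  have sub1 : `[m, M] `<=` I.
    move=> t; rewrite I2piE /= in_itv/= => /andP[mt tM].
    by rewrite (ltW (lt_le_trans m0 mt)) (ltW (le_lt_trans tM M2)).
  have sub2 : `[m, M] `<=` `[-1, x].
    move=> t; rewrite /= !in_itv/= => /andP[mt tM].
    by rewrite (le_trans _ mt) ?(le_trans tM (ltW Mx))// (le_trans (lerN10 _)) // ltW.
  rewrite (@Rintegral_supported `[m, M] _ psi sub2); last first.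
    by move=> t; rewrite /= in_itv/=; exact: H0.
  by rewrite (@Rintegral_supported `[m, M] _ psi sub1).
have dphi (x : R) : is_derive x 1 phi (psi x).
  have [x1|x1] := ltP (-1) x.
    have [||||] := @continuous_FTC1_closed _ psi (-1) x (x + 1).
    - by rewrite ltrDl.
    - apply: continuous_compact_integrable; first exact: segment_compact.
      exact: continuous_subspaceT.
    - exact: x1.
    - exact: cpsi.
    by move=> dF F'; apply: DeriveDef; [exact: dF|rewrite -derive1E].
  have xm : x < m by rewrite (le_lt_trans x1)// (lt_trans _ m0)// ltrN10.
  rewrite H0; last by apply/negP; rewrite negb_and -ltNge xm.
  have near0 : \forall y \near x, cst (0 : R) y = phi y.
    by near=> y; rewrite phi_l//; near: y; exact: lt_nbhsl.
  exact: near_eq_is_derive near0 (is_derive_cst (0 : R) x 1).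
exists phi; last by apply/funext => x; rewrite derive1E; apply: derive_val.
apply: (@supported_smooth_test _ m M) => //.
  by apply: smooth_primitive dphi _; exact: test_smooth.
by move=> x /negP; rewrite negb_and -!ltNge => /orP[/phi_l|/phi_r].
Unshelve. all: by end_near. Qed.

(** Subtracting a multiple of a fixed test function eta with nonzero integral makes
    the integral of any test function psi vanish, hence makes it a derivative by
    [test_primitive].  So the integral of h psi is c times that of psi, with c
    read off from eta, and [flcv] applies to h - c. *)
Theorem du_Bois_Reymond h : locally_integrable J h ->
  (forall phi, test_function phi -> \int[mu]_(x in I) (h x * phi^`()%classic x) = 0) ->
  exists c, {ae mu, forall x, I x -> h x = c}.
Proof.
move=> lh h0; have [eta teta eta0] := test_integral_neq0.
have mI := @measurable_I2pi R.
pose K := \int[mu]_(x in I) eta x.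
pose c := \int[mu]_(x in I) (h x * eta x) / K.
exists c.
have int1 (phi : R -> R) : test_function phi -> mu.-integrable I (EFin \o phi).
  by move=> tphi; apply: contI_integrable; exact: test_contI.
suff : {ae mu, forall x, I x -> h x - c = 0}.
  by move/ae_mono; apply => x H Ix; apply/eqP; rewrite -subr_eq0 H.
apply: flcv.
  by apply: (locally_integrableB lh); exact/contI_locally/contI_cst.
move=> psi tpsi.
pose k := \int[mu]_(x in I) psi x / K.
have tP := test_lincomb (- k) tpsi teta.
have P0 : \int[mu]_(x in I) (psi x + - k * eta x) = 0.
  rewrite RintegralD//; try exact: int1; last first.
    by apply: contI_integrable; apply: contIZ; exact: test_contI.
  by rewrite RintegralZl//; [rewrite mulNr /k divfK// subrr|exact: int1].
have [phi tphi phi'] := test_primitive tP P0.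
have := h0 _ tphi; rewrite phi'.
under eq_Rintegral do rewrite mulrDr mulrCA.
have i1 := integrable_test lh tpsi; have i2 := integrable_test lh teta.
rewrite RintegralD//; last first.
  have := integrable_test lh (test_lincomb (- k - 1) teta teta).
  by apply: eq_integrable => // x _ /=; congr EFin; ring.
rewrite RintegralZl// => E.
under eq_Rintegral do rewrite mulrBl.
rewrite RintegralB//; last by apply: contI_integrable; apply: contIZ; exact: test_contI.
rewrite RintegralZl//; last exact: int1.
rewrite -[RHS]E mulNr; congr (_ - _).
by rewrite /c /k; ring.
Qed.

End TestFunctions.

(** * The fourth-order equation for classical functions *)

Section PeriodicProblem.
Variable R : realType.
Notation I := (@I2pi R).
Notation normc := (@ComplexField.Normc.normc R).
Implicit Types (l : R[i]) (u v w g y : R -> R[i]).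

(** Comparison of coefficients in the factorization over the algebraically closed
    field R[i]. *)
Lemma quartic_split (b c d : R[i]) : exists l1 l2 l3 l4 : R[i],
  [/\ l1 + l2 + l3 + l4 = 0,
      l1 * l2 + l1 * l3 + l1 * l4 + l2 * l3 + l2 * l4 + l3 * l4 = b,
      l1 * l2 * l3 + l1 * l2 * l4 + l1 * l3 * l4 + l2 * l3 * l4 = c &
      l1 * l2 * l3 * l4 = d].
Proof.
pose p : {poly R[i]} := Poly [:: d; - c; b; 0; 1].
have sp : size p = 5%N by rewrite (@PolyK _ 0)//= oner_eq0.
have pc : polyseq p = [:: d; - c; b; 0; 1] by rewrite (@PolyK _ 0)//= oner_eq0.
have [r pr] := closed_field_poly_normal p.
have lp : lead_coef p = 1 by rewrite lead_coefE pc.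
rewrite lp scale1r in pr.
have : size r = 4%N.
  by apply: succn_inj; rewrite -sp pr size_prod_XsubC.
case: r pr => [|l1 [|l2 [|l3 [|l4 [|? ?]]]]]//.
rewrite !big_cons big_nil mulr1 => pr _; exists l1, l2, l3, l4.
set e1 := l1 + l2 + l3 + l4.
set e2 := l1 * l2 + l1 * l3 + l1 * l4 + l2 * l3 + l2 * l4 + l3 * l4.
set e3 := l1 * l2 * l3 + l1 * l2 * l4 + l1 * l3 * l4 + l2 * l3 * l4.
set e4 := l1 * l2 * l3 * l4.
have E : p = 'X^4 - e1%:P * 'X^3 + e2%:P * 'X^2 - e3%:P * 'X + e4%:P.
  by rewrite pr /e1 /e2 /e3 /e4 !(rmorphD, rmorphM) /=; ring.
have cE i : p`_i = (i == 4)%:R - e1 * (i == 3)%:R + e2 * (i == 2)%:R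
    - e3 * (i == 1)%:R + (if i == 0 then e4 else 0).
  by rewrite E !(coefD, coefN, coefCM, coefXn, coefX, coefC).
have c0 := cE 0; have c1 := cE 1; have c2 := cE 2; have c3 := cE 3.
rewrite pc /= !(mulr0, mulr1, subr0, addr0, sub0r, add0r, oppr0) in c0 c1 c2 c3.
by split=> //; apply: oppr_inj; rewrite ?oppr0.
Qed.

(** For l = i t the imaginary part of the equation is - b t = 0, and then its real
    part is a = 0. *)
Lemma imaginary_root (a b : R) l : b != 0 -> complex.Re l = 0 ->
  l ^+ 4 - l ^+ 2 - b%:C%C * l - a%:C%C = 0 -> l = 0 /\ a = 0.
Proof.
move=> b0; case: l => x y /= -> E.
have E1 := congr1 (@complex.Im R) E; have E2 := congr1 (@complex.Re R) E.
rewrite !exprS expr0 !ReImE /= in E1 E2.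
have /eqP : b * y = 0 by move: E1; lra.
rewrite mulf_eq0 (negbTE b0) /= => /eqP y0; split; first by rewrite y0.
by move: E2; rewrite y0; lra.
Qed.

(** The exponents l for which the first-order periodic problem is well-posed, in the
    space of functions of mean zero if P holds. *)
Definition solvable_exponent (P : Prop) l := complex.Re l != 0 \/ (l = 0 /\ P).

(** With a = 0 for P, a single argument covers the problem without constraint (a > 0)
    and the problem in the space of functions of mean zero (a = 0). *)
Definition mean0_if (P : Prop) w := P -> cintegral w = 0.

Lemma factor_estimate P l : solvable_exponent P l -> exists2 C, 0 <= C &
  forall w w' g M, cderiv w w' -> (forall x : R, I x -> w' x = l * w x + g x) ->
    w 0 = w (2 * pi) -> mean0_if P w -> (forall x : R, I x -> normc (g x) <= M) ->
    forall x, I x -> normc (w x) <= C * M.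
Proof.
move=> [l0|[-> p]].
  exists (`|complex.Re l|^-1); first by rewrite invr_ge0.
  move=> w w' g M dw wE wper _ gM x Ix; rewrite mulrC.
  exact: norm_periodic_ODE_le l0 dw wE wper gM _ Ix.
exists (4 * pi); first by rewrite mulr_ge0// pi_ge0.
move=> w w' g M dw wE wper wm gM x Ix.
by apply: (norm_mean0_le dw) => // [|y Iy]; [exact: wm|rewrite wE// mul0r add0r gM].
Qed.

(** If Re l is nonzero, integrating the equation over a period gives
    l (int w) + int g = 0, so that w inherits mean zero from g.  If l = 0, the
    primitive of g is periodic since g has mean zero, and its mean is subtracted. *)
Lemma factor_solution P l g : solvable_exponent P l -> contC g -> mean0_if P g ->
  exists w, [/\ cderiv w (fun x => l * w x + g x), w 0 = w (2 * pi) & mean0_if P w].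
Proof.
move=> [l0|[-> p]] cg gm.
  have [w dw wper] := periodic_ODE_exists l0 cg.
  exists w; split=> // p; have cw := cderiv_contC dw.
  have clw : contC (fun x => l * w x) by apply: contCM => //; exact: contC_cst.
  have := cintegral_FTC dw (contCD clw cg).
  rewrite cintegralD// cintegralZ// gm// addr0 wper subrr => /eqP.
  rewrite mulf_eq0 => /orP[/eqP l00|/eqP//].
  by move: l0; rewrite l00 eqxx.
have [G dG] := contC_primitive cg.
have cG := cderiv_contC dG.
have mc (c : R[i]) : cintegral (fun=> c) = c * (2 * pi)%:C%C.
  apply: complex_eq; rewrite !ReImE /= !mulr0 ?subr0 ?addr0 ?add0r.
    exact: Rintegral_I2pi_cst.
  exact: Rintegral_I2pi_cst.
exists (fun x => G x - cintegral G / (2 * pi)%:C%C); split.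
- apply: cderiv_eq (cderivB dG (cderiv_cst _)) => x _.
  by rewrite mul0r add0r subr0.
- congr (_ - _); have := cintegral_FTC dG cg; rewrite gm// => /eqP.
  by rewrite eq_sym subr_eq0 => /eqP.
- move=> _; rewrite cintegralB//; last exact: contC_cst.
  rewrite mc divfK ?subrr//.
  by rewrite eq_complex /= eqxx andbT gt_eqF// twopi_gt0.
Qed.

(** The function z k stands for the derivative of order k of the solution z 0. *)
Definition classical_solution (a b : R) g (z : nat -> R -> R[i]) :=
  [/\ forall k, (k < 4)%N -> cderiv (z k) (z k.+1),
      forall k, (k < 4)%N -> z k 0 = z k (2 * pi),
      contC (z 4) &
      forall x : R, I x ->
        - z 2 x + z 4 x - b%:C%C * z 1 x - a%:C%C * z 0 x = g x].

Lemma classical_solutionB (a b : R) g g' z z' : classical_solution a b g z ->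
  classical_solution a b g' z' ->
  classical_solution a b (fun x => g x - g' x) (fun k x => z k x - z' k x).
Proof.
move=> [dz pz cz ez] [dz' pz' cz' ez']; split.
- by move=> k k4; apply: cderivB; [exact: dz|exact: dz'].
- by move=> k k4; rewrite pz// pz'.
- exact: contCB.
- by move=> x Ix; rewrite -ez// -ez'//; ring.
Qed.

(** Vieta's relations for X^4 - X^2 - b X - a.  By [imaginary_root] each root gives a
    first-order problem that is well-posed. *)
Lemma characteristic_roots (a b : R) : b != 0 -> exists l1 l2 l3 l4 : R[i],
  [/\ l1 + l2 + l3 + l4 = 0,
      l1 * l2 + l1 * l3 + l1 * l4 + l2 * l3 + l2 * l4 + l3 * l4 = -1,
      l1 * l2 * l3 + l1 * l2 * l4 + l1 * l3 * l4 + l2 * l3 * l4 = b%:C%C,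
      l1 * l2 * l3 * l4 = - a%:C%C &
      [/\ solvable_exponent (a = 0) l1, solvable_exponent (a = 0) l2,
          solvable_exponent (a = 0) l3 & solvable_exponent (a = 0) l4]].
Proof.
move=> b0; have [l1 [l2 [l3 [l4 [e1 e2 e3 e4]]]]] := quartic_split (-1) b%:C%C (- a%:C%C).
exists l1, l2, l3, l4; split=> //.
have root l : (l - l1) * (l - l2) * (l - l3) * (l - l4) = 0 ->
    solvable_exponent (a = 0) l.
  move=> l0; have [Rl|Rl] := eqVneq (complex.Re l) 0; last by left.
  right; apply: (imaginary_root b0 Rl).
  rewrite -[RHS]l0 -e3 -[in LHS](opprK a%:C%C) -e4.
  transitivity (l ^+ 4 + (-1) * l ^+ 2 - (l1 * l2 * l3 + l1 * l2 * l4 + l1 * l3 * l4 + l2 * l3 * l4) * l + l1 * l2 * l3 * l4); first by ring.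
  rewrite -e2; transitivity (l ^+ 4 - 0 * l ^+ 3 + (l1 * l2 + l1 * l3 + l1 * l4 + l2 * l3 + l2 * l4 + l3 * l4) * l ^+ 2 - (l1 * l2 * l3 + l1 * l2 * l4 + l1 * l3 * l4 + l2 * l3 * l4) * l + l1 * l2 * l3 * l4); first by ring.
  by rewrite -e1; ring.
by split; apply: root; ring.
Qed.

(** Solve (D - l4) y4 = g, (D - l3) y3 = y4, (D - l2) y2 = y3, (D - l1) y1 = y2 in
    turn.  The solution is y1, and its derivatives are combinations of the y_i. *)
Lemma classical_solution_exists (a b : R) g : b != 0 -> contC g ->
  mean0_if (a = 0) g ->
  exists2 z, classical_solution a b g z & mean0_if (a = 0) (z 0).
Proof.
move=> b0 cg mg.
have [l1 [l2 [l3 [l4 [e1 e2 e3 e4 [s1 s2 s3 s4]]]]]] := characteristic_roots a b0.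
have [y4 [d4 p4 m4]] := factor_solution s4 cg mg.
have [y3 [d3 p3 m3]] := factor_solution s3 (cderiv_contC d4) m4.
have [y2 [d2 p2 m2]] := factor_solution s2 (cderiv_contC d3) m3.
have [y1 [d1 p1 m1]] := factor_solution s1 (cderiv_contC d2) m2.
pose L (c1 c2 c3 c4 : R[i]) (x : R) := c1 * y1 x + c2 * y2 x + c3 * y3 x + c4 * y4 x.
have dL c1 c2 c3 c4 : cderiv (L c1 c2 c3 c4) (fun x => c1 * (l1 * y1 x + y2 x)
    + c2 * (l2 * y2 x + y3 x) + c3 * (l3 * y3 x + y4 x) + c4 * (l4 * y4 x + g x)).
  by apply: cderivD (cderivD (cderivD _ _) _) _; exact: cderivZ.
have pL c1 c2 c3 c4 : L c1 c2 c3 c4 0 = L c1 c2 c3 c4 (2 * pi).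
  by rewrite /L p1 p2 p3 p4.
(* The coefficients come from the rule y_i' = l_i y_i + y_(i+1). *)
pose c31 := l1 ^+ 3; pose c32 := l1 ^+ 2 + l1 * l2 + l2 ^+ 2; pose c33 := l1 + l2 + l3.
pose z k : R -> R[i] := match k with
  | 0%N => L 1 0 0 0 | 1%N => L l1 1 0 0 | 2%N => L (l1 ^+ 2) (l1 + l2) 1 0
  | 3%N => L c31 c32 c33 1
  | _ => fun x => c31 * (l1 * y1 x + y2 x) + c32 * (l2 * y2 x + y3 x)
           + c33 * (l3 * y3 x + y4 x) + 1 * (l4 * y4 x + g x)
  end.
exists z; last first.
  move=> a0; rewrite -[RHS](m1 a0); congr cintegral; apply/funext => x.
  by rewrite /= /L; ring.
have cy1 := cderiv_contC d1; have cy2 := cderiv_contC d2.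
have cy3 := cderiv_contC d3; have cy4 := cderiv_contC d4.
have cZ c y : contC y -> contC (fun x => c * y x).
  by move=> cy; apply: contCM => //; exact: contC_cst.
split.
- case=> [|[|[|[|//]]]] _; [apply: cderiv_eq (dL _ _ _ _)..|exact: dL] => x _;
    rewrite /= /L /c31 /c32 /c33; ring.
- by case=> [|[|[|[|//]]]] _; exact: pL.
- exact: (contCD (contCD (contCD (cZ _ _ (contCD (cZ _ _ cy1) cy2))
    (cZ _ _ (contCD (cZ _ _ cy2) cy3))) (cZ _ _ (contCD (cZ _ _ cy3) cy4)))
    (cZ _ _ (contCD (cZ _ _ cy4) cg))).
- move=> x _.
  transitivity (z 4 x - (l1 + l2 + l3 + l4) * z 3 x
    + (l1 * l2 + l1 * l3 + l1 * l4 + l2 * l3 + l2 * l4 + l3 * l4) * z 2 x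
    - (l1 * l2 * l3 + l1 * l2 * l4 + l1 * l3 * l4 + l2 * l3 * l4) * z 1 x
    + l1 * l2 * l3 * l4 * z 0 x).
    by rewrite e1 e2 e3 e4; ring.
  by rewrite /= /L /c31 /c32 /c33; ring.
Qed.

(** The functions y_i = (D - l1) ... (D - l_(i-1)) z, for i = 1, ..., 4, satisfy the
    first-order equations (D - l_i) y_i = y_(i+1) with y_5 = g.  They are bounded
    one after the other, from y4 down to y1 = z, and the derivatives of z are then
    recovered from them. *)
Lemma classical_solution_estimate (a b : R) : b != 0 -> exists2 C, 0 <= C &
  forall g z M, classical_solution a b g z -> mean0_if (a = 0) (z 0) ->
    (forall x, I x -> normc (g x) <= M) ->
    forall x, I x -> normc (z 0 x) <= C * M /\ normc (z 4 x) <= C * M.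
Proof.
move=> b0.
have [l1 [l2 [l3 [l4 [e1 e2 e3 e4 [s1 s2 s3 s4]]]]]] := characteristic_roots a b0.
have [C1 C10 H1] := factor_estimate s1.
have [C2 C20 H2] := factor_estimate s2.
have [C3 C30 H3] := factor_estimate s3.
have [C4 C40 H4] := factor_estimate s4.
pose K3 := C3 * C4; pose K2 := C2 * K3; pose K1 := C1 * K2.
pose L1 := K2 + normc l1 * K1.
pose L2 := K3 + normc (l1 + l2) * L1 + normc (- (l1 * l2)) * K1.
pose L4 := L2 + normc b%:C%C * L1 + normc a%:C%C * K1 + 1.
have nc0 := @normc_ge0 R.
have K30 : 0 <= K3 by exact: mulr_ge0.
have K20 : 0 <= K2 by exact: mulr_ge0.
have K10 : 0 <= K1 by exact: mulr_ge0.
have L10 : 0 <= L1 by rewrite addr_ge0// mulr_ge0.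
have L20 : 0 <= L2 by rewrite !addr_ge0// mulr_ge0.
have L40 : 0 <= L4 by rewrite !addr_ge0// mulr_ge0.
exists (K1 + L4); first exact: addr_ge0.
move=> g z M [dz pz cz ez] mz gM.
have M0 : 0 <= M by apply: le_trans (nc0 _) (gM _ (I2pi0 R)).
have d0 := dz 0%N isT; have d1 := dz 1%N isT; have d2 := dz 2%N isT; have d3 := dz 3%N isT.
have p0 := pz 0%N isT; have p1 := pz 1%N isT; have p2 := pz 2%N isT; have p3 := pz 3%N isT.
have cz0 := cderiv_contC d0; have cz1 := cderiv_contC d1.
have cz2 := cderiv_contC d2; have cz3 := cderiv_contC d3.
have mz1 : cintegral (z 1) = 0 by rewrite (cintegral_FTC d0)// p0 subrr.
have mz2 : cintegral (z 2) = 0 by rewrite (cintegral_FTC d1)// p1 subrr.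
have mz3 : cintegral (z 3) = 0 by rewrite (cintegral_FTC d2)// p2 subrr.
have cZ c y : contC y -> contC (fun x => c * y x).
  by move=> cy; apply: contCM => //; exact: contC_cst.
pose y2 x := z 1 x - l1 * z 0 x.
pose y3 x := z 2 x - (l1 + l2) * z 1 x + l1 * l2 * z 0 x.
pose y4 x := z 3 x - (l1 + l2 + l3) * z 2 x + (l1 * l2 + l1 * l3 + l2 * l3) * z 1 x
  - l1 * l2 * l3 * z 0 x.
have dy2 := cderivB d1 (cderivZ l1 d0).
have dy3 := cderivD (cderivB d2 (cderivZ (l1 + l2) d1)) (cderivZ (l1 * l2) d0).
have dy4 := cderivB (cderivD (cderivB d3 (cderivZ (l1 + l2 + l3) d2))
  (cderivZ (l1 * l2 + l1 * l3 + l2 * l3) d1)) (cderivZ (l1 * l2 * l3) d0).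
have cy2 := contCB cz1 (cZ l1 _ cz0).
have cy3' := contCB cz2 (cZ (l1 + l2) _ cz1).
have cy4' := contCB cz3 (cZ (l1 + l2 + l3) _ cz2).
have cy4'' := contCD cy4' (cZ (l1 * l2 + l1 * l3 + l2 * l3) _ cz1).
have my2 : mean0_if (a = 0) y2.
  move=> a0; rewrite (cintegralB cz1 (cZ l1 _ cz0)) (cintegralZ _ cz0) mz// mz1.
  by rewrite mulr0 subr0.
have my3 : mean0_if (a = 0) y3.
  move=> a0; rewrite (cintegralD cy3' (cZ _ _ cz0)) (cintegralB cz2 (cZ _ _ cz1)).
  by rewrite (cintegralZ _ cz0) (cintegralZ _ cz1) mz// mz1 mz2 !mulr0 subr0 addr0.
have my4 : mean0_if (a = 0) y4.
  move=> a0; rewrite (cintegralB cy4'' (cZ _ _ cz0)) (cintegralD cy4' (cZ _ _ cz1)).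
  rewrite (cintegralB cz3 (cZ _ _ cz2)) (cintegralZ _ cz0) (cintegralZ _ cz1).
  by rewrite (cintegralZ _ cz2) mz// mz1 mz2 mz3 !mulr0 !subr0 addr0.
have by4 := H4 y4 _ g M dy4.
have {}by4 x : I x -> normc (y4 x) <= C4 * M.
  apply: by4 => //; last by rewrite /y4 p0 p1 p2 p3.
  move=> {}x Ix; rewrite -ez//.
  have z4E : z 4 x = z 4 x - 0 * z 3 x by rewrite mul0r subr0.
  rewrite -e3 -[a%:C%C]opprK -e4 -[- z 2 x]mulN1r -e2 [in RHS]z4E -e1 /y4; ring.
have by3 x : I x -> normc (y3 x) <= K3 * M.
  rewrite -mulrA; apply: (H3 y3 _ y4 _ dy3) => //; last by rewrite /y3 p0 p1 p2.
  by move=> {}x Ix; rewrite /y3 /y4; ring.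
have by2 x : I x -> normc (y2 x) <= K2 * M.
  rewrite -mulrA; apply: (H2 y2 _ y3 _ dy2) => //; last by rewrite /y2 p0 p1.
  by move=> {}x Ix; rewrite /y3 /y2; ring.
have bz0 x : I x -> normc (z 0 x) <= K1 * M.
  rewrite -mulrA; apply: (H1 (z 0%N) _ y2 _ d0) => //.
  by move=> {}x Ix; rewrite /y2; ring.
have bD (u v : R[i]) A B : normc u <= A * M -> normc v <= B * M ->
    normc (u + v) <= (A + B) * M.
  by move=> uA vB; rewrite mulrDl (le_trans (le_normcD _ _))// lerD.
have bZ (c u : R[i]) A : normc u <= A * M -> normc (c * u) <= normc c * A * M.
  by move=> uA; rewrite ComplexField.Normc.normcM -mulrA ler_wpM2l.
have bz1 x : I x -> normc (z 1 x) <= L1 * M.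
  move=> Ix; rewrite (_ : z 1 x = y2 x + l1 * z 0 x); last by rewrite /y2; ring.
  by apply: bD; [exact: by2|apply: bZ; exact: bz0].
have bz2 x : I x -> normc (z 2 x) <= L2 * M.
  move=> Ix; rewrite (_ : z 2 x = y3 x + (l1 + l2) * z 1 x + - (l1 * l2) * z 0 x); last by rewrite /y3; ring.
  exact: (bD _ _ _ _ (bD _ _ _ _ (by3 _ Ix) (bZ _ _ _ (bz1 _ Ix))) (bZ _ _ _ (bz0 _ Ix))).
have bz4 x : I x -> normc (z 4 x) <= L4 * M.
  move=> Ix; rewrite (_ : z 4 x = z 2 x + b%:C%C * z 1 x + a%:C%C * z 0 x + g x); last by rewrite -ez//; ring.
  apply: (bD _ _ _ _ _ _); last by rewrite mul1r gM.
  exact: (bD _ _ _ _ (bD _ _ _ _ (bz2 _ Ix) (bZ _ _ _ (bz1 _ Ix))) (bZ _ _ _ (bz0 _ Ix))).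
move=> x Ix; split.
  by apply: le_trans (bz0 _ Ix) _; rewrite ler_wpM2r// lerDl.
by apply: le_trans (bz4 _ Ix) _; rewrite ler_wpM2r// lerDr.
Qed.

End PeriodicProblem.

(** * Weak and classical derivatives *)

Section WeakDerivatives.
Variable R : realType.
Notation mu := (@lebesgue_measure R).
Notation I := (@I2pi R).
Notation J := (@I2pi_int R).
Notation normc := (@ComplexField.Normc.normc R).
Notation Re := (@complex.Re R).
Notation Im := (@complex.Im R).
Implicit Types (u v w f g : R -> R[i]) (r s h phi : R -> R).

(** The integral identity that defines a weak derivative, for real functions; real
    test functions act on the two components separately. *)
Definition weakR k r s := forall phi, test_function phi ->
  \int[mu]_(x in I) (r x * derive1n k phi x) =
  (-1) ^+ k * \int[mu]_(x in I) (s x * phi x).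

Lemma Re_signM k (z : R[i]) : Re ((-1) ^+ k * z) = (-1) ^+ k * Re z.
Proof. by rewrite -signr_odd -[in RHS]signr_odd; case: odd; rewrite ?expr0 ?expr1 ?mul1r// !mulN1r cReN. Qed.

Lemma Im_signM k (z : R[i]) : Im ((-1) ^+ k * z) = (-1) ^+ k * Im z.
Proof. by rewrite -signr_odd -[in RHS]signr_odd; case: odd; rewrite ?expr0 ?expr1 ?mul1r// !mulN1r cImN. Qed.

Lemma cintegral_test u phi : cintegral (fun x => u x * (phi x)%:C%C) =
  Complex (\int[mu]_(x in I) ((Re \o u) x * phi x)) (\int[mu]_(x in I) ((Im \o u) x * phi x)).
Proof.
apply: complex_eq => /=; apply: eq_Rintegral => x _.
  by rewrite cReM /= mulr0 subr0.
by rewrite cImM /= mulr0 add0r.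
Qed.

Lemma is_weak_derivP k u v : is_weak_deriv k u v <->
  [/\ L1loc u, L1loc v, weakR k (Re \o u) (Re \o v) & weakR k (Im \o u) (Im \o v)].
Proof.
split=> [[lu lv H]|[lu lv Hr Hi]]; split=> // phi tphi.
- have := congr1 Re (H phi tphi); rewrite Re_signM !cintegral_test. exact.
- have := congr1 Im (H phi tphi); rewrite Im_signM !cintegral_test. exact.
- apply: complex_eq; rewrite ?Re_signM ?Im_signM !cintegral_test /=.
    exact: Hr.
  exact: Hi.
Qed.

Lemma contC_L1loc u : contC u -> L1loc u.
Proof. by move=> [ur ui]; split; exact: contI_locally. Qed.

Lemma weakR_unique k r s1 s2 : locally_integrable J s1 -> locally_integrable J s2 ->
  weakR k r s1 -> weakR k r s2 -> {ae mu, forall x, I x -> s1 x = s2 x}.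
Proof.
move=> l1 l2 w1 w2; suff : {ae mu, forall x, I x -> s1 x - s2 x = 0}.
  by move/ae_mono; apply => x H Ix; apply/eqP; rewrite -subr_eq0 H.
apply: flcv; first exact: locally_integrableB.
move=> phi tphi; under eq_Rintegral do rewrite mulrBl.
rewrite RintegralB; [|exact: measurable_I2pi|exact: integrable_test..].
apply/eqP; rewrite subr_eq0; apply/eqP/(@mulrI _ ((-1) ^+ k)).
  by rewrite unitrX// unitrN unitr1.
by rewrite -(w1 _ tphi) -(w2 _ tphi).
Qed.

Lemma is_weak_deriv_unique k u v1 v2 : is_weak_deriv k u v1 -> is_weak_deriv k u v2 ->
  ae_eqI v1 v2.
Proof.
move=> /is_weak_derivP[_ [lr1 li1] wr1 wi1] /is_weak_derivP[_ [lr2 li2] wr2 wi2].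
apply: ae_mono2 (weakR_unique lr1 lr2 wr1 wr2) (weakR_unique li1 li2 wi1 wi2) _.
by move=> x Er Ei Ix; apply: complex_eq; [exact: Er|exact: Ei].
Qed.

(** By uniqueness almost everywhere, nothing depends on the representative that is
    chosen. *)
Lemma weak_derivP k u v : is_weak_deriv k u v ->
  is_weak_deriv k u (weak_deriv k u) /\ ae_eqI (weak_deriv k u) v.
Proof.
move=> uv; suff H : is_weak_deriv k u (weak_deriv k u).
  by split=> //; exact: is_weak_deriv_unique H uv.
by apply: (xgetPex (fun=> 0)); exists v.
Qed.

Lemma weakR_ae k r s1 s2 : locally_integrable J s1 -> locally_integrable J s2 ->
  {ae mu, forall x, I x -> s1 x = s2 x} -> weakR k r s1 -> weakR k r s2.
Proof.
move=> l1 l2 E w1 phi tphi; rewrite w1//; congr (_ * fine _).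
apply: ae_eq_integral; first exact: measurable_I2pi.
- exact: measurable_int (integrable_test l1 tphi).
- exact: measurable_int (integrable_test l2 tphi).
- by apply: ae_mono E _ => x E Ix /=; rewrite E.
Qed.

Lemma is_weak_deriv_ae k u v1 v2 : L1loc v2 -> ae_eqI v1 v2 ->
  is_weak_deriv k u v1 -> is_weak_deriv k u v2.
Proof.
move=> [lr li] E /is_weak_derivP[lu [lr1 li1] wr wi]; apply/is_weak_derivP; split=> //.
  by apply: (weakR_ae lr1 lr _ wr); apply: ae_mono E _ => x E Ix /=; rewrite E.
by apply: (weakR_ae li1 li _ wi); apply: ae_mono E _ => x E Ix /=; rewrite E.
Qed.

Lemma derivI_test r r' phi : derivI r r' -> contI r' -> test_function phi ->
  \int[mu]_(x in I) (r x * phi^`()%classic x) = - \int[mu]_(x in I) (r' x * phi x).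
Proof.
move=> dr cr' tphi; have [p0 p2] := test_boundary tphi.
rewrite (derivI_by_parts dr cr' (test_derivI tphi)) ?p0 ?p2 ?mulr0 ?subrr ?sub0r//.
exact/test_contI/test_derive1.
Qed.

(** Integration by parts, k times. *)
Lemma weakR_derivI (z : nat -> R -> R) n : (forall k, (k < n)%N -> derivI (z k) (z k.+1)) ->
  (forall k, (k <= n)%N -> contI (z k)) -> forall k, (k <= n)%N -> weakR k (z 0%N) (z k).
Proof.
move=> dz cz; elim=> [|k IH] kn phi tphi; first by rewrite expr0 mul1r.
rewrite derive1Sn (IH (ltnW kn)); last exact: test_derive1.
by rewrite (derivI_test (dz _ kn) (cz _ kn) tphi) exprSr mulrN1 mulrN mulNr.
Qed.

Lemma cderiv_weak (z : nat -> R -> R[i]) n :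
  (forall k, (k < n)%N -> cderiv (z k) (z k.+1)) ->
  (forall k, (k <= n)%N -> contC (z k)) ->
  forall k, (k <= n)%N -> is_weak_deriv k (z 0%N) (z k).
Proof.
move=> dz cz k kn; apply/is_weak_derivP; split.
- exact/contC_L1loc/cz.
- exact/contC_L1loc/cz.
- apply: (@weakR_derivI (fun k => Re \o z k) n) => // j jn; first by have [] := dz _ jn.
  by have [] := cz _ jn.
- apply: (@weakR_derivI (fun k => Im \o z k) n) => // j jn; first by have [] := dz _ jn.
  by have [] := cz _ jn.
Qed.

(** Testing q against the derivative of phi shows that s is a weak derivative of r.
    A primitive S of s is another function with weak derivative s, so that r - S
    is constant by the lemma of du Bois-Reymond. *)
Lemma weakR_classical k q r s : contI r -> contI s -> weakR k q r -> weakR k.+1 q s ->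
  exists r', derivI r' s /\ forall x, I x -> r x = r' x.
Proof.
move=> cr cs qr qs; have [S dS] := contI_primitive cs; have cS := derivI_contI dS.
have cB := contIB cr cS.
have [phi tphi|c Hc] := @du_Bois_Reymond _ _ (contI_locally cB).
  have tphi' := test_derive1 tphi.
  under eq_Rintegral do rewrite mulrBl.
  rewrite RintegralB; last 3 first.
    exact: measurable_I2pi.
    exact: integrable_test (contI_locally cr) tphi'.
    exact: integrable_test (contI_locally cS) tphi'.
  rewrite (derivI_test dS cs tphi) opprK.
  have := qs _ tphi; rewrite derive1Sn (qr _ tphi') exprSr mulrN1 mulNr -mulrN.
  move/mulrI => ->; first by rewrite addNr.
  by rewrite unitrX// unitrN unitr1.
exists (fun x => S x + c); split.
  by apply: derivI_eq (derivID dS (derivI_cst c)) => x _; rewrite addr0.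
move=> x Ix; have /= := @contI_ae_eq _ _ _ cB (@contI_cst R c) Hc x Ix.
by move=> <-; rewrite subrKC.
Qed.

Lemma weak_deriv_classical k u v w : contC v -> contC w ->
  is_weak_deriv k u v -> is_weak_deriv k.+1 u w ->
  exists v', cderiv v' w /\ forall x, I x -> v x = v' x.
Proof.
move=> [cr ci] [cr' ci'] /is_weak_derivP[_ _ wr wi] /is_weak_derivP[_ _ wr' wi'].
have [r [dr Er]] := weakR_classical cr cr' wr wr'.
have [s [ds Es]] := weakR_classical ci ci' wi wi'.
exists (fun x => Complex (r x) (s x)); split; first by split.
by move=> x Ix; apply: complex_eq => /=; [exact: Er|exact: Es].
Qed.

Lemma L1loc_measurable u : L1loc u ->
  measurable_fun I (Re \o u) /\ measurable_fun I (Im \o u).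
Proof. by move=> [[mr _ _] [mi _ _]]; split; apply: measurable_fun_itv_cc; [exact: mr|exact: mi]. Qed.

Lemma measurable_sqr_normc u : measurable_fun I (Re \o u) -> measurable_fun I (Im \o u) ->
  measurable_fun I (fun x => (normc (u x) ^+ 2)%:E).
Proof.
move=> mr mi; apply/measurable_EFinP.
under eq_fun do rewrite normc_sqr.
by apply: measurable_funD; apply: measurable_funX; [exact: mr|exact: mi].
Qed.

Lemma int_sqr_normc_le u K : measurable_fun I (Re \o u) -> measurable_fun I (Im \o u) ->
  {ae mu, forall x, I x -> normc (u x) <= K} ->
  (\int[mu]_(x in I) (normc (u x) ^+ 2)%:E <= (K ^+ 2 * (2 * pi))%:E)%E.
Proof.
move=> mr mi uK.
have -> : (K ^+ 2 * (2 * pi))%:E = (\int[mu]_(x in I) (K ^+ 2)%:E)%E.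
  rewrite -Rintegral_I2pi_cst /Rintegral fineK//.
  apply: integrable_fin_num; first exact: measurable_I2pi.
  exact: contI_integrable (@contI_cst R (K ^+ 2)).
apply: ae_ge0_le_integral => //.
- exact: measurable_I2pi.
- by move=> x _; rewrite lee_fin sqr_ge0.
- exact: measurable_sqr_normc.
- by move=> x _; rewrite lee_fin sqr_ge0.
- apply: ae_mono uK _ => x uK Ix; rewrite lee_fin.
  have nK := uK Ix; have n0 := normc_ge0 (u x).
  by rewrite lerXn2r// nnegrE// (le_trans n0).
Qed.

Lemma sqr_L2norm_le u K : measurable_fun I (Re \o u) -> measurable_fun I (Im \o u) ->
  {ae mu, forall x, I x -> normc (u x) <= K} -> L2norm u ^+ 2 <= K ^+ 2 * (2 * pi).
Proof.
move=> mr mi uK; have H := int_sqr_normc_le mr mi uK.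
have H0 : (0 <= \int[mu]_(x in I) (normc (u x) ^+ 2)%:E)%E.
  by apply: integral_ge0 => x _; rewrite lee_fin sqr_ge0.
rewrite /L2norm sqr_sqrtr; last by rewrite fine_ge0.
rewrite -lee_fin /Rintegral fineK// ge0_fin_numE//.
by apply: le_lt_trans H _; rewrite ltry.
Qed.

Lemma contC_bounded u : contC u -> exists K, forall x, I x -> normc (u x) <= K.
Proof.
move=> [ur ui]; have c := contID (contI_norm ur) (contI_norm ui).
have [x0 _ H] := EVT_max (ltW (twopi_gt0 R)) c.
exists (`|Re (u x0)| + `|Im (u x0)|) => x Ix; apply: le_trans (normc_le_ReIm _) _.
by apply: H; rewrite in_itv/= -I2piE.
Qed.

Lemma contC_L2 u : contC u -> L2 u.
Proof.
move=> cu; have [mr mi] := L1loc_measurable (contC_L1loc cu).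
have [K uK] := contC_bounded cu; split=> //.
apply: (@le_lt_trans _ _ (K ^+ 2 * (2 * pi))%:E); last by rewrite ltry.
by apply: int_sqr_normc_le => //; exact: aeW.
Qed.

Lemma supnorm_ge g x : contC g -> I x -> normc (g x) <= supnorm g.
Proof.
move=> /contC_bounded[K gK] Ix; apply: ub_le_sup; last by exists x.
by exists K => _ [y Iy <-]; exact: gK.
Qed.

Lemma cintegral_ae u v : L2 u -> contC v -> ae_eqI u v -> cintegral u = cintegral v.
Proof.
move=> [mr mi _] [cr ci] E.
have [ir ii] := (contI_integrable cr, contI_integrable ci).
apply: complex_eq => /=; congr fine.
  apply: ae_eq_integral; first exact: measurable_I2pi.
  - exact/measurable_EFinP.
  - exact: measurable_int ir.
  - by apply: ae_mono E _ => x E Ix /=; rewrite E.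
apply: ae_eq_integral; first exact: measurable_I2pi.
- exact/measurable_EFinP.
- exact: measurable_int ii.
- by apply: ae_mono E _ => x E Ix /=; rewrite E.
Qed.

Section Classical.
Variables (a b : R) (g : R -> R[i]) (z : nat -> R -> R[i]).
Hypothesis zsol : classical_solution a b g z.

Lemma classical_contC k : (k <= 4)%N -> contC (z k).
Proof.
have [dz _ cz _] := zsol; rewrite leq_eqVlt => /orP[/eqP ->//|k4].
exact: cderiv_contC (dz _ k4).
Qed.

Lemma classical_weak k : (k <= 4)%N -> is_weak_deriv k (z 0%N) (z k).
Proof. by have [dz _ _ _] := zsol; exact: cderiv_weak dz classical_contC k. Qed.

Lemma classical_H4 : H4 (z 0%N).
Proof.
split.
- exact/contC_L2/classical_contC.
- exists (z 4); split; first exact: classical_weak.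
  exact/contC_L2/classical_contC.
- move=> k k4; exists (z k); split.
  + exact/CI_contC/classical_contC/ltnW.
  + exact/classical_weak/ltnW.
  + by have [_ pz _ _] := zsol; exact: pz.
Qed.

Lemma classical_solves : solves a b g (z 0%N).
Proof.
have [_ _ _ ez] := zsol.
have [_ E1] := weak_derivP (@classical_weak 1 isT).
have [_ E2] := weak_derivP (@classical_weak 2 isT).
have [_ E4] := weak_derivP (@classical_weak 4 isT).
apply: ae_mono2 E1 (ae_mono2 E2 E4 (fun x => @conj _ _)) _ => x E1' [E2' E4'] Ix.
by rewrite E1'// E2'// E4'// ez.
Qed.

(** Both L^2 norms are at most the square root of 2 pi times the supremum. *)
Lemma classical_H4norm_le K : (forall x, I x -> normc (z 0 x) <= K) ->
  (forall x, I x -> normc (z 4 x) <= K) ->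
  H4norm (z 0%N) <= Num.sqrt (2 * (2 * pi)) * K.
Proof.
move=> z0K z4K.
have K0 : 0 <= K by apply: le_trans (normc_ge0 _) (z0K _ (I2pi0 R)).
have [lr E4] := weak_derivP (@classical_weak 4 isT).
have [_ l4 _] := lr.
have [mr mi] := L1loc_measurable (contC_L1loc (classical_contC (leq0n 4))).
have [mr4 mi4] := L1loc_measurable l4.
have B0 : L2norm (z 0%N) ^+ 2 <= K ^+ 2 * (2 * pi) by apply: sqr_L2norm_le => //; exact: aeW.
have B4 : L2norm (weak_deriv 4 (z 0%N)) ^+ 2 <= K ^+ 2 * (2 * pi).
  by apply: sqr_L2norm_le => //; apply: ae_mono E4 _ => x E Ix; rewrite E// z4K.
have p0 := twopi_gt0 R.
rewrite /H4norm -[X in _ * X]ger0_norm// -sqrtr_sqr -sqrtrM ?ler_sqrt; last 2 first.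
- by rewrite !mulr_ge0// pi_ge0.
- by rewrite !mulr_ge0 ?sqr_ge0// pi_ge0.
by apply: le_trans (lerD B0 B4) _; rewrite -mulr2n -mulr_natl; lra.
Qed.

End Classical.

(** The fourth weak derivative of v is, almost everywhere, the continuous function
    w4 computed from the equation; each w_k is then a classical primitive of
    w_(k+1) by [weak_deriv_classical]. *)
Lemma weak_solution_classical a b f v : contC f -> H4 v -> solves a b f v ->
  exists2 z, classical_solution a b f z & ae_eqI v (z 0%N).
Proof.
move=> cf [L2v [v4 [wv4 _]] tr] sv.
have [w0 [/CI_contC c0 d0 p0]] := tr 0%N isT.
have [w1 [/CI_contC c1 d1 p1]] := tr 1%N isT.
have [w2 [/CI_contC c2 d2 p2]] := tr 2%N isT.
have [w3 [/CI_contC c3 d3 p3]] := tr 3%N isT.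
have lv : L1loc v by case: wv4.
have vw0 : ae_eqI v w0.
  apply: is_weak_deriv_unique d0; apply/is_weak_derivP; split=> // phi _;
  by rewrite expr0 mul1r.
have [_ E1] := weak_derivP d1; have [_ E2] := weak_derivP d2.
have [d4 _] := weak_derivP wv4.
pose w4 x := w2 x + b%:C%C * w1 x + a%:C%C * w0 x + f x.
have cZ (c : R[i]) y : contC y -> contC (fun x => c * y x).
  by move=> cy; apply: contCM => //; exact: contC_cst.
have c4 : contC w4 := contCD (contCD (contCD c2 (cZ _ _ c1)) (cZ _ _ c0)) cf.
have {}d4 : is_weak_deriv 4 v w4.
  apply: is_weak_deriv_ae d4; first exact: contC_L1loc.
  apply: ae_mono2 (ae_mono2 E1 E2 (fun x => @conj _ _))
    (ae_mono2 vw0 sv (fun x => @conj _ _)) _.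
  move=> x [E1' E2'] [E0' Es] Ix; rewrite /w4 -E1'// -E2'// -E0'// -Es//; ring.
have [z3 [dz3 e3]] := weak_deriv_classical c3 c4 d3 d4.
have [z2 [dz2 e2]] := weak_deriv_classical c2 c3 d2 d3.
have [z1 [dz1 e1]] := weak_deriv_classical c1 c2 d1 d2.
have [z0 [dz0 e0]] := weak_deriv_classical c0 c1 d0 d1.
exists (fun k => match k with 0%N => z0 | 1%N => z1 | 2%N => z2 | 3%N => z3 | _ => w4 end).
  have I0 := I2pi0 R; have I2 := I2pi2pi R.
  split=> //=.
  - by case=> [|[|[|[|//]]]] _; [exact: cderiv_eq e1 dz0|exact: cderiv_eq e2 dz1|
      exact: cderiv_eq e3 dz2|exact: dz3].
  - by case=> [|[|[|[|//]]]] _; rewrite -?(e0 _ I0) -?(e0 _ I2) -?(e1 _ I0) -?(e1 _ I2)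
      -?(e2 _ I0) -?(e2 _ I2) -?(e3 _ I0) -?(e3 _ I2).
  - by move=> x Ix; rewrite -e2// -e1// -e0// /w4; ring.
by apply: ae_mono vw0 _ => x E Ix; rewrite E// e0.
Qed.

End WeakDerivatives.

(** * Well-posedness and convergence *)

Section WellPosed.
Variable R : realType.
Notation mu := (@lebesgue_measure R).
Notation I := (@I2pi R).
Notation normc := (@ComplexField.Normc.normc R).
Notation Re := (@complex.Re R).
Notation Im := (@complex.Im R).

Lemma normr_Rintegral_le (r : R -> R) (M : R) : contI r ->
  (forall x, I x -> `|r x| <= M) -> `|\int[mu]_(x in I) r x| <= M * (2 * pi).
Proof.
move=> cr rM; have mI := @measurable_I2pi R.
have := @le_normr_Rintegral _ _ R mu I r mI (contI_integrable cr).
move=> /le_trans; apply; rewrite -Rintegral_I2pi_cst; apply: le_Rintegral => //.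
  exact: contI_integrable (contI_norm cr).
exact: contI_integrable (@contI_cst R M).
Qed.

(** The mean is continuous for uniform convergence. *)
Lemma cintegral_cvg_eq0 (f_ : nat -> R -> R[i]) (f : R -> R[i]) :
  contC f -> (forall m, contC (f_ m)) -> cvgCI f_ f ->
  (forall m, cintegral (f_ m) = 0) -> cintegral f = 0.
Proof.
move=> cf cf_ fcvg f0.
have S0 : supnorm (fun x => f_ m x - f x) * (2 * pi) @[m --> \oo] --> (0 : R).
  by rewrite -[X in _ --> X](mul0r (2 * pi)); apply: cvgZl.
have key (y : R) : (forall m, `|y| <= supnorm (fun x => f_ m x - f x) * (2 * pi)) -> y = 0.
  move=> H; apply/eqP; rewrite -normr_le0.
  rewrite -(cvg_lim (@Rhausdorff R) S0); apply: limr_ge; last exact: nearW.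
  by apply/cvg_ex; exists 0; exact: S0.
have c m : contC (fun x => f_ m x - f x) by exact: contCB.
have E m : cintegral (fun x => f_ m x - f x) = - cintegral f.
  by rewrite cintegralB// f0 sub0r.
apply: complex_eq => /=; apply: key => m; rewrite -normrN.
  have -> : - (\int[mu]_(x in I) Re (f x)) = Re (- cintegral f) by rewrite cReN.
  rewrite -(E m); apply: (normr_Rintegral_le (c m).1) => x Ix.
  by apply: le_trans (Re_le_normc _) _; exact: supnorm_ge.
have -> : - (\int[mu]_(x in I) Im (f x)) = Im (- cintegral f) by rewrite cImN.
rewrite -(E m); apply: (normr_Rintegral_le (c m).2) => x Ix.
by apply: le_trans (Im_le_normc _) _; exact: supnorm_ge.
Qed.

Definition admissible (a : R) (u : R -> R[i]) := H4 u /\ mean0_if (a = 0) u.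

(** Any other solution is classical, and the estimate with right-hand side 0 bounds
    the difference by 0. *)
Lemma classical_unique_solution (a b : R) (f : R -> R[i]) z : b != 0 ->
  contC f -> classical_solution a b f z -> mean0_if (a = 0) (z 0%N) ->
  unique_solution (admissible a) a b f (z 0%N).
Proof.
move=> b0 cf zs zm; split.
- by split=> //; exact: classical_H4 zs.
- exact: classical_solves zs.
- move=> v [Hv vm] sv; have [y ys vy] := weak_solution_classical cf Hv sv.
  have ym : mean0_if (a = 0) (y 0%N).
    move=> a0; rewrite -(vm a0); symmetry; apply: cintegral_ae vy; first by case: Hv.
    exact: classical_contC ys 0%N isT.
  have [C _ HC] := classical_solution_estimate a b0.
  have dm : mean0_if (a = 0) (fun x => y 0%N x - z 0%N x).
    move=> a0; rewrite cintegralB ?ym ?zm ?subrr//.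
      exact: classical_contC ys 0%N isT.
    exact: classical_contC zs 0%N isT.
  apply: ae_mono vy _ => x E Ix; rewrite E//; apply/eqP; rewrite -subr_eq0; apply/eqP.
  have [|H _] := HC _ _ 0 (classical_solutionB ys zs) dm _ x Ix.
    by move=> t _; rewrite subrr ComplexField.Normc.normc0.
  apply: ComplexField.Normc.eq0_normc; apply/eqP.
  by rewrite eq_le normc_ge0 andbT; rewrite mulr0 in H.
Qed.

Theorem well_posed (a b : R) (f : R -> R[i]) (f_ : nat -> R -> R[i]) : b != 0 ->
  contC f -> (forall m, contC (f_ m)) -> cvgCI f_ f ->
  (forall m, mean0_if (a = 0) (f_ m)) ->
  exists (u : R -> R[i]) (u_ : nat -> R -> R[i]),
    [/\ unique_solution (admissible a) a b f u,
        forall m, unique_solution (admissible a) a b (f_ m) (u_ m) &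
        cvgH4 u_ u].
Proof.
move=> b0 cf cf_ fcvg fm_.
have fm : mean0_if (a = 0) f.
  by move=> a0; apply: cintegral_cvg_eq0 fcvg _ => // m; exact: fm_.
have [z zs zm] := classical_solution_exists b0 cf fm.
have /choice[z_ Hz_] : forall m, exists y, classical_solution a b (f_ m) y /\ mean0_if (a = 0) (y 0%N).
  by move=> m; have [y ys ym] := classical_solution_exists b0 (cf_ m) (fm_ m); exists y.
exists (z 0%N), (fun m => z_ m 0%N); split.
- exact: classical_unique_solution.
- by move=> m; have [ys ym] := Hz_ m; exact: classical_unique_solution.
have [C C0 HC] := classical_solution_estimate a b0.
pose S m := supnorm (fun x => f_ m x - f x).
pose D := Num.sqrt (2 * (2 * pi)) * C : R.
have bound m : 0 <= H4norm (fun x => z_ m 0%N x - z 0%N x) <= D * S m.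
  rewrite sqrtr_ge0 /=; have [ys ym] := Hz_ m.
  have ds := classical_solutionB ys zs.
  have dm : mean0_if (a = 0) (fun x => z_ m 0%N x - z 0%N x).
    move=> a0; rewrite cintegralB ?ym ?zm ?subrr//.
      exact: classical_contC ys 0%N isT.
    exact: classical_contC zs 0%N isT.
  have gS x : I x -> normc (f_ m x - f x) <= S m.
    by move=> Ix; apply: (@supnorm_ge _ (fun x => f_ m x - f x)) => //; exact: contCB.
  rewrite /D -mulrA; apply: (classical_H4norm_le ds) => x Ix.
    by have [] := HC _ _ _ ds dm gS x Ix.
  by have [] := HC _ _ _ ds dm gS x Ix.
apply: (squeeze_cvgr (f := fun=> 0) (h := fun m => D * S m)).
- exact: nearW.
- exact: cvg_cst.
- by rewrite -[X in _ --> X](mulr0 D); apply: cvgZr.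
Qed.

End WellPosed.

Lemma L2inner1 (R : realType) (u : R -> R[i]) : L2inner u (fun=> 1) = cintegral u.
Proof. by rewrite /L2inner; congr cintegral; apply/funext => x; rewrite conjc1 mulr1. Qed.

Theorem theorem1p4 (R : realType) (a b : R) (f : R -> R[i])
    (f_ : nat -> R -> R[i]) (ha : 0 <= a) (hb : b != 0)
    (hf : CI f)
    (hf_ : forall m : nat, CI (f_ m) /\ f_ m 0 = f_ m (2 * pi))
    (hcvg : cvgCI f_ f) :
  (0 < a ->
     exists (u : R -> R[i]) (u_ : nat -> R -> R[i]),
       [/\ unique_solution (@H4 R) a b f u,
           forall m : nat, unique_solution (@H4 R) a b (f_ m) (u_ m) &
           cvgH4 u_ u])
  /\
  (a = 0 ->
     (forall m : nat, L2inner (f_ m) (fun=> 1) = 0) ->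
     exists (u : R -> R[i]) (u_ : nat -> R -> R[i]),
       [/\ unique_solution (@H40 R) a b f u,
           forall m : nat, unique_solution (@H40 R) a b (f_ m) (u_ m) &
           cvgH4 u_ u]).
Proof.
have cf := (CI_contC f).1 hf.
have cf_ m := (CI_contC (f_ m)).1 (hf_ m).1.
have transfer X g u : (forall v, X v <-> admissible a v) ->
    unique_solution (admissible a) a b g u -> unique_solution X a b g u.
  move=> XA [Au su uu]; split=> //; first exact/XA.
  by move=> v /XA Av sv; exact: uu.
have finish X : (forall v, X v <-> admissible a v) ->
    (forall m, mean0_if (a = 0) (f_ m)) ->
    exists u u_, [/\ unique_solution X a b f u,
      forall m, unique_solution X a b (f_ m) (u_ m) & cvgH4 u_ u].
  move=> XA fm; have [u [u_ [Hu Hu_ uu_]]] := well_posed hb cf cf_ hcvg fm.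
  by exists u, u_; split=> [|m|//]; exact: transfer.
split=> [a0|a0 fm]; apply: finish.
- move=> v; split=> [Hv|[]//]; split=> // a00; by rewrite a00 ltxx in a0.
- by move=> m a00; rewrite a00 ltxx in a0.
- move=> v; split=> [[Hv v0]|[Hv v0]]; split=> //; rewrite ?L2inner1; last exact: v0.
  by rewrite L2inner1 in v0.
- by move=> m _; rewrite -L2inner1.
Qed.
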